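(* Let $\varphi=(\varphi_1,\dots,\varphi_m)\in\mathcal S(n,m)$ be a Schur-Agler mapping satisfying condition (C) at $e_1\in\partial\mathbb B^n$, that is, $$L:=\liminf_{z\to e_1}\frac{1-|\varphi(z)|^2}{1-|z|^2}<\infty .$$ Let $2\le k\le n$. Then the restricted $K$-limits at $e_1$ of the following functions ($L$, $L$ and $0$ respectively) can be improved to $K$-limits, that is: (i) the function $\dfrac{1-\varphi_1(z)}{1-z_1}$ has $K$-limit $L$ at $e_1$; (ii) the function $(D_1\varphi_1)(z)$ has $K$-limit $L$ at $e_1$; (v) the function $\dfrac{(D_k\varphi_1)(z)}{(1-z_1)^{1/2}}$ has $K$-limit $0$ at $e_1$.
   Context: $\mathbb B^n$ is the open unit ball of $\mathbb C^n$ with the Euclidean norm $|\cdot|$ and standard Hermitian inner product $\langle\cdot,\cdot\rangle$ (linear in the first variable). $e_1$ is the first standard basis vector of $\mathbb C^n$. In condition (C), $z$ tends to $e_1$ unrestrictedly within $\mathbb B^n$. $D_k=\partial/\partial z_k$, and $(1-z_1)^{1/2}$ is the principal branch. The Schur-Agler class $\mathcal S(n,m)$ is the set of all holomorphic mappings $\varphi:\mathbb B^n\to\mathbb B^m$ such that the Hermitian kernel $$k^\varphi(z,w)=\frac{1-\langle\varphi(z),\varphi(w)\rangle}{1-\langle z,w\rangle}$$ on $\mathbb B^n\times\mathbb B^n$ is positive semidefinite. For $\zeta\in\partial\mathbb B^n$ and $\alpha>0$, the Koranyi region is $D_\alpha(\zeta)=\{z\in\mathbb B^n: |1-\langle z,\zeta\rangle|\le\frac{\alpha}{2}(1-|z|^2)\}$.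 A function $f:\mathbb B^n\to\mathbb C$ has $K$-limit $\ell$ at $\zeta$ if $f(z)\to\ell$ whenever $z\to\zeta$ within a Koranyi region $D_\alpha(\zeta)$. A curve $\Gamma:[0,1)\to\mathbb B^n$ with $\Gamma(t)\to\zeta$ as $t\to1$, and with projection $\gamma(t)=\langle\Gamma(t),\zeta\rangle\zeta$, is called restricted if $\lim_{t\to1}|\Gamma-\gamma|^2/(1-|\gamma|^2)=0$ and $|\zeta-\gamma|/(1-|\gamma|^2)\le A$ for some constant $A>0$. The function $f$ has restricted $K$-limit $\ell$ at $\zeta$ if $f\to\ell$ along every restricted curve. For general holomorphic maps $\mathbb B^n\to\mathbb B^m$ satisfying condition (C) at $e_1$, the limits (i), (ii), (v) are asserted (Rudin) only as restricted $K$-limits.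
   Formalization: The formal theorem adds the normalization that φ has radial limit e_1 at e_1; without it the claim fails, e.g. for φ(z) = -z, which satisfies (C) with L = 1 while (1-φ_1)/(1-z_1) is unbounded on the radius. *)

(* Defs.v *)
From HB Require Import structures.
From mathcomp Require Import all_boot all_order all_algebra.
From mathcomp Require Import all_classical all_reals all_analysis.
From mathcomp Require Import complex.

Set Implicit Arguments.
Unset Strict Implicit.
Unset Printing Implicit Defensive.
Import Order.TTheory GRing.Theory Num.Theory.
Import numFieldNormedType.Exports.

Local Open Scope classical_set_scope.
Local Open Scope ring_scope.
Local Open Scope complex_scope.

(* R[i] itself carries no topology; the topological and normed structures of
   MathComp-Analysis attach to it through this numClosedFieldType. *)
Definition cplx (R : realType) : numClosedFieldType := R[i].

Section Ball.
Context {R : realType}.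
Local Notation C := (cplx R).

(* [dotmx u v] is \sum_i u_i * conj v_i, whereas the norm of 'rV[C]_n is the
   sup norm (which induces the same topology as the Euclidean norm). *)
Definition sqnorm n (u : 'rV[C]_n) : R := complex.Re (dotmx u u).

Definition cball n : set 'rV[C]_n := [set z | sqnorm z < 1].

Definition basis_vec n (k : 'I_n) : 'rV[C]_n := delta_mx 0 k.

Definition koranyi n (zeta : 'rV[C]_n) (alpha : R) : set 'rV[C]_n :=
  [set z | cball z /\
    `|1 - dotmx z zeta| <= (alpha / 2 * (1 - sqnorm z))%:C :> C].

Definition K_limit n (f : 'rV[C]_n -> C) (zeta : 'rV[C]_n) (l : C) : Prop :=
  forall alpha : R, 0 < alpha ->
    f z @[z --> within (koranyi zeta alpha) (nbhs zeta)] --> l.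

(* The order of C only compares numbers whose difference is real, so the
   inequality includes the fact that the quadratic form is real. *)
Definition psd_kernel (T : Type) (D : set T) (k : T -> T -> C) : Prop :=
  forall (N : nat) (x : 'I_N -> T) (c : 'I_N -> C),
    (forall i, D (x i)) ->
    0 <= \sum_(i < N) \sum_(j < N) c i * (c j)^* * k (x i) (x j).

Definition schur_agler_kernel n m (phi : 'rV[C]_n -> 'rV[C]_m)
    (z w : 'rV[C]_n) : C :=
  (1 - dotmx (phi z) (phi w)) / (1 - dotmx z w).

(* Maps of the ball are total functions whose values off the ball are
   irrelevant; the ball is open, so differentiability (over C) at its points
   is holomorphy on it. *)
Definition schur_agler n m (phi : 'rV[C]_n -> 'rV[C]_m) : Prop :=
  [/\ forall z, cball z -> cball (phi z),
      forall z, cball z -> differentiable phi z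
    & psd_kernel (@cball n) (schur_agler_kernel phi)].

Definition julia_liminf n m (phi : 'rV[C]_n -> 'rV[C]_m)
    (zeta : 'rV[C]_n) : \bar R :=
  limf_einf (fun z => ((1 - sqnorm (phi z)) / (1 - sqnorm z))%:E)
            (within (@cball n) (nbhs zeta)).

Definition condition_C n m (phi : 'rV[C]_n -> 'rV[C]_m)
    (zeta : 'rV[C]_n) : Prop :=
  (julia_liminf phi zeta < +oo)%E.

(* Condition (C) forces the radial limit of phi at zeta to exist and to be some
   unit vector. Statements about the first component of phi assume, as in
   Rudin's normalization phi(e_1) = e_1, that this vector is e_1; -id satisfies
   (C) at e_1 but (1 - phi_1) / (1 - z_1) is then unbounded on the radius. *)
Definition radial_limit n m (phi : 'rV[C]_n -> 'rV[C]_m)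
    (zeta : 'rV[C]_n) (eta : 'rV[C]_m) : Prop :=
  phi ((r%:C : C) *: zeta) @[r --> (1 : R)^'-] --> eta.

Definition partial_C n (k : 'I_n) (f : 'rV[C]_n -> C) (z : 'rV[C]_n) : C :=
  'D_(basis_vec k) f z.

(* [sqrtc] is the root with nonnegative real part, i.e. the principal branch on
   the right half-plane. The generic [sqrtC] of numClosedFieldType is instead
   the root with nonnegative imaginary part. *)
Definition principal_sqrt (z : C) : C := sqrtc z.

End Ball.

(* Main.v *)
From HB Require Import structures.
Require Import Defs.
From mathcomp Require Import all_boot all_order all_algebra.
From mathcomp Require Import all_classical all_reals all_analysis.
From mathcomp Require Import complex.
From mathcomp Require Import ring lra.
Import Order.TTheory GRing.Theory Num.Theory.
Import numFieldNormedType.Exports.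
Local Open Scope classical_set_scope.
Local Open Scope ring_scope.
Local Open Scope complex_scope.

(* Let k be the Schur-Agler kernel of phi and k_w = k(., w). By condition (C) the kernel
   extends, by a limit along points realizing the lower limit, to a positive kernel on
   the ball and one more point e_1, with k(e_1, e_1) = L and
   k(z, e_1) = h(z) = (1 - phi_1(z)) / (1 - z_1). Cauchy-Schwarz for k_z and k_{e_1} is
   Julia's inequality, which bounds k(z, z) on every Koranyi region. Along the radius
   |k_{e_1} - k_r|^2 = L - 2 Re h(r) + k(r, r) tends to 0, since 2 Re h(r) is at least
   (1 + r) k(r, r). So |h(z) - k(z, r)|^2 <= k(z, z) |k_{e_1} - k_r|^2 is small uniformly
   on the region, while k(z, r) tends to the conjugate of h(r), which is close to L;
   this is (i).
   No Cauchy estimate is needed for the derivatives: pairing k_{e_1} - k_r with the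
   combination (1 - <b, a>) k_b - (1 - |a|^2) k_a, b = a + t v, and letting t tend to 0
   bounds the derivative at a of h - k(., r) in the direction v, and the fact that the
   norm of that combination is nonnegative bounds the derivative of phi itself. As
   D_v phi_1 = v_1 h - (1 - z_1) D_v h, this gives (ii) and (v). *)

(** * Squared moduli and positive kernels *)

Section SquaredModulus.
Set Implicit Arguments.
Unset Strict Implicit.
Local Open Scope ring_scope.
Context {R : realType}.
Local Notation C := (cplx R).
Local Notation Re := (@complex.Re R).
Local Notation Im := (@complex.Im R).
Implicit Types x y z : C.

(** The modulus on [C] is itself complex-valued; its square with values in [R] keeps the estimates
    among real inequalities. *)
Definition nsq (z : C) : R := Re z ^+ 2 + Im z ^+ 2.

Lemma ReD x y : Re (x + y) = Re x + Re y.
Proof. by case: x; case: y. Qed.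
Lemma ReN x : Re (- x) = - Re x.
Proof. by case: x. Qed.
Lemma ReB x y : Re (x - y) = Re x - Re y.
Proof. by case: x; case: y. Qed.
Lemma ImB x y : Im (x - y) = Im x - Im y.
Proof. by case: x; case: y. Qed.
Lemma ReM x y : Re (x * y) = Re x * Re y - Im x * Im y.
Proof. by case: x; case: y. Qed.
Lemma conjcE x : x^*%C = x^*.
Proof. by []. Qed.
Lemma Re_conj x : Re x^* = Re x.
Proof. by rewrite -conjcE; case: x. Qed.

Lemma nsq_ge0 z : 0 <= nsq z.
Proof. by rewrite addr_ge0 ?sqr_ge0. Qed.

Lemma nsq_eq0 z : (nsq z == 0) = (z == 0).
Proof.
by rewrite paddr_eq0 ?sqr_ge0// !sqrf_eq0 eq_complex.
Qed.

Lemma nsq_gt0 z : (0 < nsq z) = (z != 0).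
Proof. by rewrite lt_def nsq_ge0 andbT nsq_eq0. Qed.

Lemma nsqM x y : nsq (x * y) = nsq x * nsq y.
Proof. by case: x => a b; case: y => c d; rewrite /nsq /=; ring. Qed.

Lemma nsqN x : nsq (- x) = nsq x.
Proof. by case: x => a b; rewrite /nsq /= !sqrrN. Qed.

Lemma nsqV x : nsq x^-1 = (nsq x)^-1.
Proof.
have [->|x0] := eqVneq x 0; first by rewrite invr0 /nsq /= expr0n/= addr0 invr0.
apply: (mulfI (_ : nsq x != 0)); first by rewrite nsq_eq0.
by rewrite -nsqM !divff ?nsq_eq0// /nsq /= expr1n expr0n/= addr0.
Qed.

Lemma nsq_conj x : nsq x^* = nsq x.
Proof. by rewrite -conjcE; case: x => a b; rewrite /nsq /= sqrrN. Qed.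

Lemma nsq0 : nsq 0 = 0.
Proof. by apply/eqP; rewrite nsq_eq0. Qed.

Lemma nsq1 : nsq 1 = 1.
Proof. by rewrite /nsq /= expr1n expr0n addr0. Qed.

Lemma nsq_real (r : R) : nsq (r%:C : C) = r ^+ 2.
Proof. by rewrite /nsq /= expr0n addr0. Qed.

Lemma nsqX2 x : nsq (x ^+ 2) = nsq x ^+ 2.
Proof. by rewrite !expr2 nsqM. Qed.

Lemma nsqD_le x y : nsq (x + y) <= 2 * nsq x + 2 * nsq y.
Proof.
case: x => a b; case: y => c d; rewrite /nsq /= -subr_ge0.
have -> : 2 * (a ^+ 2 + b ^+ 2) + 2 * (c ^+ 2 + d ^+ 2) -
  ((a + c) ^+ 2 + (b + d) ^+ 2) = (a - c) ^+ 2 + (b - d) ^+ 2 by ring.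
by rewrite addr_ge0 ?sqr_ge0.
Qed.

Lemma nsqB_le x y : nsq (x - y) <= 2 * nsq x + 2 * nsq y.
Proof. by rewrite -(nsqN y) nsqD_le. Qed.

Lemma nsq_distC x y : nsq (x - y) = nsq (y - x).
Proof. by rewrite -opprB nsqN. Qed.

Lemma sqr_Re_le x : Re x ^+ 2 <= nsq x.
Proof. by rewrite lerDl sqr_ge0. Qed.

Lemma mul_conj x : x * x^* = (nsq x)%:C.
Proof.
rewrite -conjcE; case: x => a b; apply/eqP; rewrite eq_complex /nsq /=.
by apply/andP; split; apply/eqP; ring.
Qed.

Lemma norm_nsq (x : C) : `|x| = (Num.sqrt (nsq x))%:C.
Proof. exact: normc_def. Qed.

Lemma ltnorm_nsq (x : C) (e : R) : 0 < e -> (`|x| < e%:C) = (nsq x < e ^+ 2).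
Proof.
move=> e0; rewrite norm_nsq ltcR -[in LHS](ger0_norm (ltW e0)) -sqrtr_sqr.
by rewrite ltr_sqrt// exprn_gt0.
Qed.

Lemma lenorm_nsq (x : C) (e : R) : `|x| <= e%:C -> nsq x <= e ^+ 2.
Proof.
rewrite norm_nsq lecR => h.
by rewrite -(sqr_sqrtr (nsq_ge0 x)) lerXn2r// nnegrE ?sqrtr_ge0// (le_trans _ h) ?sqrtr_ge0.
Qed.

Lemma complex_gt0 (e : C) : 0 < e -> exists2 r : R, 0 < r & e = r%:C.
Proof.
case: e => a b; rewrite ltcE /= => /andP[/eqP -> a0]; by exists a.
Qed.

Lemma cvg_nsqP {T : Type} {F : set_system T} {FF : Filter F} (f : T -> C) (l : C) :
  f @ F --> l <-> forall e : R, 0 < e -> \forall t \near F, nsq (f t - l) < e.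
Proof.
split=> [/cvgrPdist_lt fl e e0|fl].
  have s0 : 0 < Num.sqrt e by rewrite sqrtr_gt0.
  have := fl (Num.sqrt e)%:C; rewrite ltcR => /(_ s0).
  apply: filterS => t; rewrite ltnorm_nsq// sqr_sqrtr ?(ltW e0)//.
  by rewrite nsq_distC.
apply/cvgrPdist_lt => _ /complex_gt0[r r0 ->].
have := fl (r ^+ 2); rewrite exprn_gt0// => /(_ isT).
by apply: filterS => t; rewrite ltnorm_nsq// nsq_distC.
Qed.

Lemma cvg_real {T : Type} {F : set_system T} {FF : Filter F} (f : T -> R) (l : R) :
  f @ F --> l -> (fun t => (f t)%:C : C) @ F --> (l%:C : C).
Proof.
move=> /cvgrPdist_lt fl; apply/cvg_nsqP => e e0.
have s0 : 0 < Num.sqrt e by rewrite sqrtr_gt0.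
apply: filterS (fl _ s0) => t.
rewrite -rmorphB nsq_real => ft.
rewrite -(sqr_sqrtr (ltW e0)) -real_normK ?num_real// ltrXn2r//.
by rewrite distrC.
Qed.

Lemma cvg_Re {T : Type} {F : set_system T} {FF : Filter F} (f : T -> C) (l : C) :
  f @ F --> l -> (fun t => Re (f t)) @ F --> Re l.
Proof.
move=> /cvg_nsqP fl; apply/cvgrPdist_lt => e e0.
have := fl (e ^+ 2); rewrite exprn_gt0// => /(_ isT).
apply: filterS => t ft; rewrite distrC -ReB -(ger0_norm (ltW e0)) -ltr_sqr ?nnegrE//.
by rewrite !real_normK ?num_real// (le_lt_trans _ ft)// sqr_Re_le.
Qed.

Lemma cvg_conj {T : Type} {F : set_system T} {FF : Filter F} (f : T -> C) (l : C) :
  f @ F --> l -> (fun t => (f t)^* : C) @ F --> (l^* : C).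
Proof.
move=> /cvg_nsqP fl; apply/cvg_nsqP => e e0.
by apply: filterS (fl _ e0) => t; rewrite -rmorphB nsq_conj.
Qed.

Lemma cvg_nsq {T : Type} {F : set_system T} {FF : Filter F} (f : T -> C) (l : C) :
  f @ F --> l -> (fun t => nsq (f t)) @ F --> nsq l.
Proof.
move=> fl; have -> : (fun t => nsq (f t)) = (fun t => Re (f t * (f t)^*)).
  by apply/funext => t; rewrite mul_conj.
have -> : nsq l = Re (l * l^*) by rewrite mul_conj.
by apply: cvg_Re; exact: cvgM fl (cvg_conj fl).
Qed.

(** Since [0 <= l] in [C] includes that [l] is real, the limit is first shown to be fixed by
    conjugation, as a limit of such numbers. *)
Lemma cvg_ge0 {T : Type} {F : set_system T} {FF : ProperFilter F} (f : T -> C) (l : C) :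
  f @ F --> l -> (forall t, 0 <= f t) -> 0 <= l.
Proof.
move=> fl f0.
have cl : (fun t => (f t)^*) = f.
  apply/funext => t; have := f0 t; rewrite -conjcE; case: (f t) => a b.
  by rewrite lecE /= => /andP[/eqP -> _]; rewrite oppr0.
have Rl : 0 <= Re l.
  apply: (cvgr_to_ge (cvg_Re fl)); apply: nearW => t.
  by have := f0 t; rewrite lecE /= => /andP[].
have /eqP : l^* = l.
  apply: (cvg_unique _ (cvg_conj fl)) => /=; first exact: norm_hausdorff.
  by rewrite cl.
rewrite -conjcE; move: Rl; case: (l) => a b /= a0.
rewrite eq_complex /= => /andP[_ /eqP b0]; rewrite lecE /= a0 andbT.
by apply/eqP; move: b0; lra.
Qed.

(** Reading [k x y] as the inner product of vectors f_x and f_y, this is the inner product of c1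
    f_x1 + c2 f_x2 with d1 f_y1 + d2 f_y2. *)
Definition pairing (T : Type) (k : T -> T -> C)
    (c1 : C) (x1 : T) (c2 : C) (x2 : T) (d1 : C) (y1 : T) (d2 : C) (y2 : T) : C :=
  c1 * d1^* * k x1 y1 + c1 * d2^* * k x1 y2 +
  (c2 * d1^* * k x2 y1 + c2 * d2^* * k x2 y2).

Lemma pairing_self_ge0 (T : Type) (D : set T) (k : T -> T -> C)
    (d1 : C) (y1 : T) (d2 : C) (y2 : T) :
  psd_kernel D k -> D y1 -> D y2 -> 0 <= Re (pairing k d1 y1 d2 y2 d1 y1 d2 y2).
Proof.
move=> psd Dy1 Dy2.
have := psd 2 (fun i : 'I_2 => nth y1 [:: y1; y2] i) (fun i : 'I_2 => nth 0 [:: d1; d2] i).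
rewrite !big_ord_recl !big_ord0 /= !addr0 => hY.
suff : 0 <= pairing k d1 y1 d2 y2 d1 y1 d2 y2 by rewrite lecE => /andP[].
by apply: hY; case=> -[|[|//]] /=.
Qed.

(** No Hilbert space is built: the usual quadratic argument runs on the form itself, at the four
    points with coefficients [c1], [c2], [s * d1], [s * d2]. *)
Lemma psd_cauchy_schwarz (T : Type) (D : set T) (k : T -> T -> C)
    (c1 : C) (x1 : T) (c2 : C) (x2 : T) (d1 : C) (y1 : T) (d2 : C) (y2 : T) :
  psd_kernel D k -> (forall u v, k v u = (k u v)^*) ->
  D x1 -> D x2 -> D y1 -> D y2 ->
  nsq (pairing k c1 x1 c2 x2 d1 y1 d2 y2) <=
  Re (pairing k c1 x1 c2 x2 c1 x1 c2 x2) * Re (pairing k d1 y1 d2 y2 d1 y1 d2 y2).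
Proof.
move=> psd herm Dx1 Dx2 Dy1 Dy2.
set B := pairing _ _ _ _ _ _ _ _ _.
set X := pairing _ _ _ _ _ _ _ _ _.
set Y := pairing _ _ _ _ _ _ _ _ _.
have H s : 0 <= X + s^* * B + s * B^* + s * s^* * Y.
  pose x (i : 'I_4) := nth x1 [:: x1; x2; y1; y2] i.
  pose c (i : 'I_4) := nth 0 [:: c1; c2; s * d1; s * d2] i.
  have := psd 4 x c; suff -> : \sum_(i < 4) \sum_(j < 4) c i * (c j)^* * k (x i) (x j) =
      X + s^* * B + s * B^* + s * s^* * Y.
    by apply; case=> -[|[|[|[|//]]]] /=.
  rewrite !big_ord_recl !big_ord0 /c /x /= /B /X /Y /pairing.
  rewrite ?conjcE !rmorphD !rmorphM /= !conjCK.
  rewrite (herm x1 y1) (herm x1 y2) (herm x2 y1) (herm x2 y2).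
  by ring.
have X0 : 0 <= Re X := pairing_self_ge0 c1 c2 psd Dx1 Dx2.
(* Taking s = -t B with t real aligns the phases, so that both cross terms become -t |B|^2. *)
have {}H (t : R) : 0 <= Re X - 2 * t * nsq B + t ^+ 2 * nsq B * Re Y.
  have := H (- t%:C * B); rewrite -!conjcE lecE => /andP[_] /=.
  move: (X) (Y) (B) => [a b] [c d] [e f]; rewrite /nsq /= => h; apply: etrans h.
  by congr (0 <= _); ring.
have Y0 : 0 <= Re Y := pairing_self_ge0 d1 d2 psd Dy1 Dy2.
have B0 := nsq_ge0 B.
have [Yz|Yn] := eqVneq (Re Y) 0.
  have [->|Bn] := eqVneq (nsq B) 0; first by rewrite mulr_ge0.
  (* With [Re Y = 0] the bound is affine in t, and this t would make it -1. *)
  have := H ((Re X + 1) / nsq B / 2); rewrite Yz mulr0 addr0.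
  suff -> : 2 * ((Re X + 1) / nsq B / 2) * nsq B = Re X + 1 by lra.
  by field.
have Yp : 0 < Re Y by rewrite lt_def Yn.
(* The minimizer of the quadratic. *)
have := H (Re Y)^-1.
have -> : Re X - 2 * (Re Y)^-1 * nsq B + (Re Y)^-1 ^+ 2 * nsq B * Re Y =
  (Re X * Re Y - nsq B) / Re Y by field.
by rewrite pmulr_lge0 ?invr_gt0// subr_ge0.
Qed.

Lemma psd_cauchy_schwarz1 (T : Type) (D : set T) (k : T -> T -> C) (x y : T) :
  psd_kernel D k -> (forall u v, k v u = (k u v)^*) -> D x -> D y ->
  nsq (k x y) <= Re (k x x) * Re (k y y).
Proof.
move=> psd herm Dx Dy.
have := psd_cauchy_schwarz 1 0 1 0 psd herm Dx Dx Dy Dy.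
by rewrite /pairing !conjC1 !conjC0 !(mul1r, mul0r, mulr0, addr0).
Qed.

Lemma psd_kernel_lim (S T : Type) (F : set_system S) {FF : ProperFilter F} (D : set T)
    (ks : S -> T -> T -> C) (k : T -> T -> C) :
  (forall s, psd_kernel D (ks s)) ->
  (forall u v, D u -> D v -> (fun s => ks s u v) @ F --> k u v) ->
  psd_kernel D k.
Proof.
move=> psd cv N x c Dx.
apply: (cvg_ge0 (F := F) _ (fun s => psd s N x c Dx)).
apply: cvg_big => [|i _]; first exact: add_continuous.
apply: cvg_big => [|j _]; first exact: add_continuous.
by apply: cvgMl_tmp; exact: cv.
Qed.

End SquaredModulus.

(** * The Hermitian inner product *)

(* [dotmx] and [sqnorm], locked because unification keeps unfolding the originals. *)
HB.lock Definition hdot (R : realType) n (u w : 'rV[cplx R]_n) : cplx R :=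
  \sum_i u 0 i * ((w 0 i)^*)%R.

Arguments hdot {R n} u w.

HB.lock Definition hsq (R : realType) n (u : 'rV[cplx R]_n) : R :=
  \sum_i nsq (u 0 i).

Arguments hsq {R n} u.

Section HermitianProduct.
Local Open Scope ring_scope.
Set Implicit Arguments.
Unset Strict Implicit.
Context {R : realType}.
Local Notation C := (cplx R).
Local Notation Re := (@complex.Re R).
Implicit Types n : nat.

Lemma dotmx_hdot n (u w : 'rV[C]_n) : dotmx u w = hdot u w.
Proof.
by rewrite hdot.unlock dotmxE mxE; apply: eq_bigr => i _; rewrite !mxE.
Qed.

Lemma hdotDl n (u v w : 'rV[C]_n) : hdot (u + v) w = hdot u w + hdot v w.
Proof.
rewrite hdot.unlock -big_split; apply: eq_bigr => i _.
by rewrite mxE mulrDl.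
Qed.

Lemma hdotZl n (t : C) (u w : 'rV[C]_n) : hdot (t *: u) w = t * hdot u w.
Proof.
rewrite hdot.unlock mulr_sumr; apply: eq_bigr => i _.
by rewrite mxE mulrA.
Qed.

Lemma hdotBl n (u v w : 'rV[C]_n) : hdot (u - v) w = hdot u w - hdot v w.
Proof. by rewrite -scaleN1r hdotDl hdotZl mulN1r. Qed.

Lemma hdotC n (u w : 'rV[C]_n) : hdot w u = (hdot u w)^*.
Proof.
rewrite hdot.unlock rmorph_sum; apply: eq_bigr => i _.
by rewrite rmorphM /= conjCK mulrC.
Qed.

Lemma hdotBr n (u v w : 'rV[C]_n) : hdot w (u - v) = hdot w u - hdot w v.
Proof. by rewrite (hdotC (u - v)) hdotBl rmorphB /= -(hdotC u) -(hdotC v). Qed.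

Lemma hdot_self n (u : 'rV[C]_n) : hdot u u = (hsq u)%:C.
Proof.
rewrite hdot.unlock hsq.unlock rmorph_sum.
by apply: eq_bigr => i _; rewrite mul_conj.
Qed.

Lemma sqnorm_hsq n (u : 'rV[C]_n) : sqnorm u = hsq u.
Proof. by rewrite /sqnorm dotmx_hdot hdot_self. Qed.

Lemma hsq_ge0 n (u : 'rV[C]_n) : 0 <= hsq u.
Proof. by rewrite hsq.unlock sumr_ge0// => i _; exact: nsq_ge0. Qed.

Lemma nsq_coord_le n (u : 'rV[C]_n) i : nsq (u 0 i) <= hsq u.
Proof.
rewrite hsq.unlock (bigD1 i)//= lerDl sumr_ge0// => j _; exact: nsq_ge0.
Qed.

Lemma nsq_coord2_le n (u : 'rV[C]_n) i j : i != j ->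
  nsq (u 0 i) + nsq (u 0 j) <= hsq u.
Proof.
move=> ij; rewrite hsq.unlock (bigD1 i)//= lerD2l (bigD1 j) 1?eq_sym//=.
by rewrite lerDl sumr_ge0// => l _; exact: nsq_ge0.
Qed.

Lemma hsqZ n (t : C) (u : 'rV[C]_n) : hsq (t *: u) = nsq t * hsq u.
Proof.
by rewrite !hsq.unlock mulr_sumr; apply: eq_bigr => i _; rewrite mxE nsqM.
Qed.

Lemma hsqB n (u w : 'rV[C]_n) :
  hsq (u - w) = hsq u + hsq w - 2 * Re (hdot u w).
Proof.
have -> : hsq (u - w) = Re (hdot (u - w) (u - w)) by rewrite hdot_self.
rewrite hdotBl !hdotBr !ReB (hdotC u w) Re_conj !hdot_self /=; ring.
Qed.

Lemma hdot_cauchy_schwarz n (u w : 'rV[C]_n) :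
  nsq (hdot u w) <= hsq u * hsq w.
Proof.
have [h _] := CauchySchwarz (@dotmx C n) u w.
have {h} : `|dotmx u w| ^+ 2 <= dotmx u u * dotmx w w by [].
by rewrite !dotmx_hdot !hdot_self -!rmorphM /= norm_nsq -rmorphXn /= lecR
  sqr_sqrtr ?nsq_ge0.
Qed.

Lemma hdot_basisr n (u : 'rV[C]_n) k : hdot u (basis_vec k) = u 0 k.
Proof.
rewrite hdot.unlock (bigD1 k)//= big1 => [|i ik].
  by rewrite mxE !eqxx conjC1 mulr1 addr0.
by rewrite mxE (negbTE ik) conjC0 mulr0.
Qed.

Lemma hsq_basis n (k : 'I_n) : hsq (basis_vec k : 'rV[C]_n) = 1.
Proof. by apply: complexI; rewrite -hdot_self hdot_basisr mxE !eqxx. Qed.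

Lemma ball_hdot_neq0 n (u w : 'rV[C]_n) :
  cball u -> hsq w <= 1 -> 1 - hdot u w != 0.
Proof.
rewrite /cball /= sqnorm_hsq => u1 w1; rewrite subr_eq0; apply/negP => /eqP e.
have := hdot_cauchy_schwarz u w; rewrite -e nsq1 leNgt => /negP; apply.
by rewrite (le_lt_trans _ u1)// ler_piMr ?hsq_ge0.
Qed.

(** The left side is |1 - <b,a>|^2 times the squared pseudohyperbolic distance of a and b. Along a
    complex line through a, its terms of first order in t cancel. *)
Lemma pseudohyperbolic_line n (a v : 'rV[C]_n) (t : C) :
  let b := t *: v + a in
  nsq (1 - hdot b a) - (1 - hsq a) * (1 - hsq b) =
  nsq t * (hsq v * (1 - hsq a) + nsq (hdot v a)).
Proof.
move=> b.
have -> : hsq b = nsq t * hsq v + hsq a + 2 * Re (t * hdot v a).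
  have := hsqB (t *: v) (- a); rewrite opprK -/b => ->.
  rewrite hsqZ -scaleN1r hsqZ nsqN nsq1 mul1r scaleN1r.
  have -> : hdot (t *: v) (- a) = - (t * hdot v a).
    by rewrite hdotZl (hdotC (- a)) -scaleN1r hdotZl rmorphM rmorphN1 /= -hdotC mulN1r mulrN.
  by rewrite ReN; ring.
have -> : hdot b a = t * hdot v a + (hsq a)%:C.
  by rewrite /b hdotDl hdotZl hdot_self.
move: (hdot v a) (hsq a) (hsq v) => p sa sv {b}.
case: t => t1 t2; case: p => p1 p2; rewrite /nsq /=; ring.
Qed.

Lemma cvg_coord {T : Type} {F : set_system T} {FF : Filter F} n
  (f : T -> 'rV[C]_n) (u : 'rV[C]_n) i :
  f @ F --> u -> (fun t => f t 0 i) @ F --> u 0 i.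
Proof.
move=> fu; have := @coord_continuous C 1 n 0 i u.
by move=> cu; apply: cvg_trans cu; exact: (cvg_app (fun M : 'rV[C]_n => M 0 i) fu).
Qed.

Lemma cvg_hdotl {T : Type} {F : set_system T} {FF : Filter F} n
  (f : T -> 'rV[C]_n) (u w : 'rV[C]_n) :
  f @ F --> u -> (fun t => hdot (f t) w) @ F --> hdot u w.
Proof.
move=> fu; rewrite hdot.unlock.
apply: cvg_big => [|i _]; first exact: add_continuous.
 apply: cvgMr_tmp; exact: cvg_coord.
Qed.

Lemma cvg_hsq {T : Type} {F : set_system T} {FF : Filter F} n
  (f : T -> 'rV[C]_n) (u : 'rV[C]_n) :
  f @ F --> u -> (fun t => hsq (f t)) @ F --> hsq u.
Proof.
move=> fu; rewrite hsq.unlock.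
apply: cvg_big => [|i _]; first exact: add_continuous.
 apply: cvg_nsq; exact: cvg_coord.
Qed.

End HermitianProduct.

(** * Lower limits *)

Section LowerLimit.
Local Open Scope ring_scope.
Set Implicit Arguments.
Unset Strict Implicit.
Context {R : realType} {T : choiceType} {X : filteredType T}.
Variables (f : X -> R) (F : set_system X).
Context {FF : ProperFilter F}.
Hypothesis f_ge0 : \forall t \near F, 0 <= f t.
Hypothesis f_fin : (limf_einf (fun t => (f t)%:E) F < +oo)%E.
Let L := fine (limf_einf (fun t => (f t)%:E) F).

Lemma limf_einf_fin : limf_einf (fun t => (f t)%:E) F = L%:E.
Proof.
rewrite /L fineK// fin_numElt f_fin andbT (@lt_le_trans _ _ 0%E)// limf_einfE.
apply: (@le_trans _ _ (ereal_inf ((fun t => (f t)%:E) @` [set t | 0 <= f t]))).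
  by apply: le_ereal_inf_tmp => _ [t /= t0 <-]; rewrite lee_fin.
by apply: ereal_sup_ubound; exists [set t | 0 <= f t].
Qed.

Lemma limf_einf_gt (e : R) : 0 < e -> \forall t \near F, L - e < f t.
Proof.
move=> e0; have : ((L - e)%:E < limf_einf (fun t => (f t)%:E) F)%E.
  by rewrite limf_einf_fin lte_fin ltrBlDr ltrDl.
rewrite limf_einfE => /ereal_sup_gt[_ [V FV <-]] h.
apply: filterS FV => t Vt; rewrite -lte_fin (lt_le_trans h)//.
by apply: ereal_inf_lbound; exists t.
Qed.

(** Otherwise the infimum of [f] over [P], one of those whose supremum is the lower limit, would be
    at least L + e. *)
Lemma limf_einf_lt (e : R) (P : set X) : 0 < e -> F P ->
  exists2 t, P t & f t < L + e.
Proof.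
move=> e0 FP; apply: contrapT => nP.
have : ((L + e)%:E <= limf_einf (fun t => (f t)%:E) F)%E.
  rewrite limf_einfE; apply: (@le_trans _ _ (ereal_inf ((fun t => (f t)%:E) @` P))).
    apply: le_ereal_inf_tmp => _ [t Pt <-]; rewrite lee_fin leNgt; apply/negP => ft.
    by apply: nP; exists t.
  by apply: ereal_sup_ubound; exists P.
by rewrite limf_einf_fin lee_fin gerDl leNgt e0.
Qed.

End LowerLimit.

(** * The Schur-Agler kernel *)

Section SchurAglerKernel.
Local Open Scope ring_scope.
Set Implicit Arguments.
Unset Strict Implicit.
Context {R : realType} {n m : nat}.
Local Notation C := (cplx R).
Local Notation Re := (@complex.Re R).
Local Notation e1 := (basis_vec ord0).
Local Notation ball_e1 := (within (@cball R n.+1) (nbhs (e1 : 'rV[C]_n.+1))).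

Lemma e1_coord p : (e1 : 'rV[C]_p.+1) 0 0 = 1.
Proof. by rewrite mxE !eqxx. Qed.

Lemma hdot_e1l p (w : 'rV[C]_p.+1) : hdot e1 w = (w 0 0)^*.
Proof. by rewrite hdotC hdot_basisr. Qed.

Lemma hsq_radial p (r : R) : hsq ((r%:C : C) *: e1 : 'rV[C]_p.+1) = r ^+ 2.
Proof. by rewrite hsqZ nsq_real hsq_basis mulr1. Qed.

Lemma cball_hsq p (z : 'rV[C]_p) : cball z <-> hsq z < 1.
Proof. by rewrite /cball /= sqnorm_hsq. Qed.

Lemma radial_cball p (r : R) : 0 < r -> r < 1 -> cball ((r%:C : C) *: e1 : 'rV[C]_p.+1).
Proof. by move=> r0 r1; apply/cball_hsq; rewrite hsq_radial; nra. Qed.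

Lemma near_left1 : \forall r \near (1 : R)^'-, 0 < r /\ r < 1.
Proof.
near=> r; split; near: r; first exact: nbhs_left_gt.
exact: nbhs_left_lt.
Unshelve. all: by end_near. Qed.

(** Carries what holds in the ball near e_1 over to the radius, and shows that the filter [ball_e1]
    is proper. *)
Lemma cvg_radial : (fun r : R => (r%:C : C) *: e1) @ (1 : R)^'- --> ball_e1.
Proof.
have cv : (fun r : R => (r%:C : C) *: e1) @ (1 : R)^'- --> (e1 : 'rV[C]_n.+1).
  rewrite -[X in _ --> X]scale1r; apply: cvgZr_tmp.
  by apply: (@cvg_real _ _ _ _ id 1); exact: cvg_at_left_filter cvg_id.
move=> P /cv nP.
have {}nP : \forall r \near (1 : R)^'-, cball ((r%:C : C) *: e1 : 'rV[C]_n.+1) ->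
  P ((r%:C : C) *: e1) by exact: nP.
rewrite /nbhs /=; near=> r; have [r0 r1] : 0 < r /\ r < 1.
  by near: r; exact: near_left1.
have := radial_cball n r0 r1; near: r; exact: nP.
Unshelve. all: by end_near. Qed.

Global Instance ball_e1_proper : ProperFilter ball_e1.
Proof.
split; last exact: within_filter.
by move=> /cvg_radial /filter_not_empty.
Qed.

Lemma ball_e1_cball : \forall z \near ball_e1, cball z.
Proof. exact: withinT. Qed.

Lemma ball_e1_cvg : ball_e1 --> (e1 : 'rV[C]_n.+1).
Proof. exact: cvg_within. Qed.

Variable phi : 'rV[C]_n.+1 -> 'rV[C]_m.+1.
Hypothesis phi_SA : schur_agler phi.

Definition sa_kernel z w : C := (1 - hdot (phi z) (phi w)) / (1 - hdot z w).
Definition sa_diag z : R := (1 - hsq (phi z)) / (1 - hsq z).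
(** Formally [sa_kernel z e1] with [phi e1 = e1]; hence its role as the kernel function at the
    boundary point. *)
Definition sa_quotient z : C := (1 - phi z 0 0) / (1 - z 0 0).
Local Notation K := sa_kernel.
Local Notation q := sa_diag.
Local Notation h := sa_quotient.

Lemma phi_cball z : cball z -> hsq (phi z) < 1.
Proof. by case: phi_SA => b _ _ /b /cball_hsq. Qed.

Lemma sa_kernel_self z : K z z = (q z)%:C.
Proof.
by rewrite /K /q !hdot_self -!(rmorphB, rmorph1 (real_complex R)) -fmorph_div.
Qed.

Lemma sa_kernelC z w : K w z = (K z w)^*.
Proof.
by rewrite /K fmorph_div !rmorphB !rmorph1 /= -(hdotC (phi z)) -(hdotC z).
Qed.

Lemma psd_sa_kernel : psd_kernel (@cball R n.+1) K.
Proof.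
case: phi_SA => _ _; suff -> : schur_agler_kernel phi = K by [].
by apply/funext => z; apply/funext => w; rewrite /schur_agler_kernel !dotmx_hdot.
Qed.

Lemma sa_diag_ge0 z : cball z -> 0 <= q z.
Proof.
move=> z1; rewrite divr_ge0// subr_ge0 ltW//; first exact: phi_cball.
exact/cball_hsq.
Qed.

Lemma sa_diag_mul z : cball z -> q z * (1 - hsq z) = 1 - hsq (phi z).
Proof.
by move=> /cball_hsq z1; rewrite /q divfK// subr_eq0 gt_eqF.
Qed.

Lemma one_sub_hdot_neq0 (z w : 'rV[C]_n.+1) : cball z -> hsq w <= 1 -> 1 - hdot z w != 0.
Proof. exact: ball_hdot_neq0. Qed.

Lemma sa_kernel_cs z w : cball z -> cball w ->
  nsq (1 - hdot (phi z) (phi w)) <= nsq (1 - hdot z w) * (q z * q w).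
Proof.
move=> z1 w1; have /= := psd_cauchy_schwarz1 psd_sa_kernel sa_kernelC z1 w1.
rewrite !sa_kernel_self /= => /(ler_wpM2l (nsq_ge0 (1 - hdot z w))).
by rewrite -nsqM mulrC /K divfK// one_sub_hdot_neq0// ltW//; exact/cball_hsq.
Qed.

(** Expand the square and use |phi(z)| < 1. Thus convergence of the first coordinate to 1 forces
    convergence of the whole image to e_1. *)
Lemma hsq_phi_sub_e1 z : cball z -> hsq (phi z - e1) <= 2 * Re (1 - phi z 0 0).
Proof.
move=> z1; rewrite hsqB hsq_basis hdot_basisr ReB /=.
by have := phi_cball z1; lra.
Qed.

Lemma cvg_hdot_phi {T : Type} {F : set_system T} {FF : Filter F}
    (f : T -> 'rV[C]_n.+1) (w : 'rV[C]_m.+1) :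
  (\forall t \near F, cball (f t)) -> (fun t => phi (f t) 0 0) @ F --> (1 : C) ->
  (fun t => hdot (phi (f t)) w) @ F --> (w 0 0)^*.
Proof.
move=> fB phi1; have cv : (fun t => 2 * hsq w * Re (1 - phi (f t) 0 0)) @ F --> 2 * hsq w * 0.
  apply: cvgMl_tmp; rewrite [X in _ --> X](_ : _ = Re (1 - 1)); last by rewrite subrr.
  by apply: cvg_Re; exact: cvgB (cvg_cst _) phi1.
rewrite mulr0 in cv.
apply/cvg_nsqP => e e0; near=> t.
have ft : cball (f t) by near: t.
apply: (@le_lt_trans _ _ (2 * hsq w * Re (1 - phi (f t) 0 0))); last first.
  by near: t; exact: cvgr_lt cv _ e0.
rewrite -hdot_e1l -hdotBl (le_trans (hdot_cauchy_schwarz _ _))//.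
by rewrite (mulrC 2) -mulrA mulrC ler_wpM2l ?hsq_ge0//; exact: hsq_phi_sub_e1.
Unshelve. all: by end_near. Qed.

Lemma cvg_sa_kernel {T : Type} {F : set_system T} {FF : Filter F}
    (f : T -> 'rV[C]_n.+1) (w : 'rV[C]_n.+1) :
  cball w -> (\forall t \near F, cball (f t)) ->
  (fun t => phi (f t) 0 0) @ F --> (1 : C) ->
  (fun t => hdot (f t) w) @ F --> (w 0 0)^* ->
  (fun t => K (f t) w) @ F --> (h w)^*.
Proof.
move=> w1 fB phi1 fw; rewrite /sa_kernel /sa_quotient fmorph_div !rmorphB !rmorph1 /=.
apply: cvgM; first by apply: cvgB; [exact: cvg_cst|exact: cvg_hdot_phi].
apply: cvgV; last by apply: cvgB; [exact: cvg_cst|].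
rewrite -(rmorph1 Num.conj) -rmorphB fmorph_eq0 -hdot_basisr.
by apply: ball_hdot_neq0 => //; rewrite hsq_basis.
Qed.

End SchurAglerKernel.

(** * Extension of the kernel to the boundary point *)

Section BoundaryKernel.
Local Open Scope ring_scope.
Set Implicit Arguments.
Unset Strict Implicit.
Context {R : realType} {n m : nat}.
Local Notation C := (cplx R).
Local Notation Re := (@complex.Re R).
Local Notation e1 := (basis_vec ord0).
Local Notation ball_e1 := (within (@cball R n.+1) (nbhs (e1 : 'rV[C]_n.+1))).
Variable phi : 'rV[C]_n.+1 -> 'rV[C]_m.+1.
Hypothesis phi_SA : schur_agler phi.
Hypothesis phi_C : condition_C phi e1.
Hypothesis phi_e1 : radial_limit phi e1 e1.
Local Notation K := (sa_kernel phi).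
Local Notation q := (sa_diag phi).
Local Notation h := (sa_quotient phi).
Let L := fine (julia_liminf phi e1).
Local Notation rad r := ((r%:C : C) *: (e1 : 'rV[C]_n.+1)).

Lemma julia_liminfE : julia_liminf phi e1 = limf_einf (fun z => (q z)%:E) ball_e1.
Proof.
rewrite /julia_liminf; congr limf_einf.
by apply/funext => z; rewrite /sa_diag !sqnorm_hsq.
Qed.

Lemma near_sa_diag_ge0 : \forall z \near ball_e1, 0 <= q z.
Proof. by apply: filterS (ball_e1_cball (R := R) (n := n)) => z; exact: sa_diag_ge0. Qed.

Lemma sa_diag_gt (e : R) : 0 < e -> \forall z \near ball_e1, L - e < q z.
Proof.
have := phi_C; rewrite /L /condition_C julia_liminfE => fin.
exact: limf_einf_gt near_sa_diag_ge0 fin e.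
Qed.

Lemma sa_diag_lt (e : R) (P : set 'rV[C]_n.+1) : 0 < e -> ball_e1 P ->
  exists2 z, P z & q z < L + e.
Proof.
have := phi_C; rewrite /L /condition_C julia_liminfE => fin.
exact: limf_einf_lt near_sa_diag_ge0 fin e P.
Qed.

Lemma near_hsq_sub_e1 (e : R) : 0 < e -> \forall z \near ball_e1, hsq (z - e1) < e.
Proof.
move=> e0; suff cv : (fun z => hsq (z - e1)) @ ball_e1 --> (0 : R).
  exact: cvgr_lt cv _ e0.
rewrite -[X in _ --> X](_ : hsq (e1 - e1 : 'rV[C]_n.+1) = 0); last first.
  by rewrite subrr -(scale0r e1) hsqZ nsq0 mul0r.
apply: cvg_hsq; apply: cvgB; [exact: ball_e1_cvg|exact: cvg_cst].
Qed.

Lemma cvg_phi1_radial : (fun r : R => phi (rad r) 0 0) @ (1 : R)^'- --> (1 : C).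
Proof. by rewrite -(e1_coord (R := R) m); apply: cvg_coord; exact: phi_e1. Qed.

(** At the radial point [q] is at most 1 / (1 - r^2), which the factor |1 - <e_1, r e_1>|^2 = (1 -
    r)^2 of the kernel inequality outweighs. *)
Lemma radial_weight_le (r : R) : 0 < r -> r < 1 -> (1 - r) ^+ 2 * q (rad r) <= 1 - r.
Proof.
move=> r0 r1; have B := radial_cball n r0 r1.
have := sa_diag_mul phi B; rewrite hsq_radial => E.
have := hsq_ge0 (phi (rad r)); have := sa_diag_ge0 phi_SA B => q0 p0.
have : q (rad r) * (1 - r) <= 1 by nra.
by nra.
Qed.

(* The points realizing the lower limit have images close to [e1]: compare them,
   through the kernel, with a point of the radius, where the limit of [phi] is known. *)
Lemma julia_approach (e : R) : 0 < e -> exists z : 'rV[C]_n.+1,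
  [/\ cball z, hsq (z - e1) < e, nsq (1 - phi z 0 0) < e & `|q z - L| < e].
Proof.
(* The final bound is 2 (2 d) + 2 d = 6 d, below e = 8 d. *)
move=> e0; set d := e / 8; have d0 : 0 < d by rewrite divr_gt0.
have M0 : 0 < `|L| + 1 by rewrite ltr_wpDl.
have [r [[r0 r1] rd rphi]] : exists r : R, [/\ 0 < r /\ r < 1,
    (`|L| + 1) * (1 - r) < d & 2 * Re (1 - phi (rad r) 0 0) < d].
  suff : \forall r \near (1 : R)^'-, [/\ 0 < r /\ r < 1,
    (`|L| + 1) * (1 - r) < d & 2 * Re (1 - phi (rad r) 0 0) < d].
    by move=> /filter_ex.
  near=> r; split.
  - by near: r; exact: near_left1.
  - rewrite mulrC -ltr_pdivlMr// ltrBlDl -ltrBlDr; near: r; apply: nbhs_left_gt.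
    by rewrite ltrBlDl ltrDr divr_gt0.
  - near: r; suff cv : (fun r : R => 2 * Re (1 - phi (rad r) 0 0)) @ (1 : R)^'- --> (2 * 0 : R).
      by rewrite mulr0 in cv; exact: cvgr_lt cv _ d0.
    apply: cvgMl_tmp; rewrite [X in _ --> X](_ : _ = Re (1 - 1)); last by rewrite subrr.
    by apply: cvg_Re; exact: cvgB (cvg_cst _) cvg_phi1_radial.
have B := radial_cball n r0 r1; set w := rad r.
have nearw : \forall z \near ball_e1, nsq (1 - hdot z w) * q w * (`|L| + 1) < 2 * d.
  suff cv : (fun z => nsq (1 - hdot z w) * q w * (`|L| + 1)) @ ball_e1 -->
      (1 - r) ^+ 2 * q w * (`|L| + 1).
    apply: cvgr_lt cv _ _.
    by have := radial_weight_le r0 r1; rewrite -/w; nra.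
  apply: cvgMr_tmp; apply: cvgMr_tmp.
  have -> : (1 - r) ^+ 2 = nsq (1 - hdot e1 w).
    by rewrite hdot_e1l /w mxE e1_coord mulr1 -conjcE conjc_real -nsq_real rmorphB.
  apply: cvg_nsq; apply: cvgB; first exact: cvg_cst.
  by apply: cvg_hdotl; exact: ball_e1_cvg.
(* The minimum with 1 also gives [q z < |L| + 1], the factor built into [nearw]. *)
have me0 : 0 < Num.min e 1 by rewrite lt_min e0 ltr01.
have [z [[z1 ze] [zw zq]] zq'] := sa_diag_lt me0
  (filterI (filterI (ball_e1_cball (n := n)) (near_hsq_sub_e1 e0)) (filterI nearw (sa_diag_gt e0))).
have [zqe zq1] : q z < L + e /\ q z < `|L| + 1.
  split; first by rewrite (lt_le_trans zq')// lerD2l ge_min lexx.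
  by rewrite (lt_le_trans zq')// lerD// ?ler_norm// ge_min lexx orbT.
exists z; split=> //; last by rewrite ltr_distl zq zqe.
have kzw := sa_kernel_cs phi_SA z1 B; rewrite -/w in kzw.
have w_e1 : hsq (phi w - e1) <= d by rewrite (le_trans (hsq_phi_sub_e1 phi_SA B))// ltW.
(* The kernel inequality compares phi(z) with phi(w); the choice of r compares phi(w) with e_1. *)
have -> : 1 - phi z 0 0 = (1 - hdot (phi z) (phi w)) + hdot (phi z) (phi w - e1).
  by rewrite hdotBr hdot_basisr; ring.
rewrite (le_lt_trans (nsqD_le _ _))//.
have c2 : nsq (hdot (phi z) (phi w - e1)) <= d.
  rewrite (le_trans (hdot_cauchy_schwarz _ _))//.
  by have := phi_cball phi_SA z1; have := hsq_ge0 (phi z); have := hsq_ge0 (phi w - e1); nra.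
have c1 : nsq (1 - hdot (phi z) (phi w)) < 2 * d.
  rewrite (le_lt_trans kzw)// (le_lt_trans _ zw)// mulrCA mulrC ler_wpM2l//; last exact: ltW.
  exact: (mulr_ge0 (nsq_ge0 _) (sa_diag_ge0 phi_SA B)).
have -> : e = 8 * d by rewrite /d; field.
by lra.
Unshelve. all: by end_near. Qed.

(** The entries at [None] are the limits of those of [K] at points tending to e_1 along which phi_1
    tends to 1 and [q] tends to L. *)
Definition boundary_kernel (u v : option 'rV[C]_n.+1) : C :=
  match u, v with
  | Some z, Some w => K z w
  | Some z, None => h z
  | None, Some w => (h w)^*
  | None, None => L%:C
  end.
Local Notation D := [set u : option 'rV[C]_n.+1 | if u is Some z then cball z else True].

Lemma boundary_kernelC u v : boundary_kernel v u = (boundary_kernel u v)^*.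
Proof.
case: u v => [z|] [w|] //=; first exact: sa_kernelC.
  by rewrite conjCK.
by rewrite -conjcE conjc_real.
Qed.

(* [None] stands for the boundary point [e1]. *)
Lemma psd_boundary_kernel : psd_kernel D boundary_kernel.
Proof.
have /choice[z_ zP] : forall j : nat, exists z : 'rV[C]_n.+1,
    [/\ cball z, hsq (z - e1) < j.+1%:R^-1, nsq (1 - phi z 0 0) < j.+1%:R^-1 &
        `|q z - L| < j.+1%:R^-1].
  by move=> j; apply: julia_approach; rewrite invr_gt0.
have zB j : cball (z_ j) by case: (zP j).
have inv0 (e : R) : 0 < e -> \forall j \near \oo, j.+1%:R^-1 < e.
  by move=> e0; exact: (near_infty_natSinv_lt (PosNum e0)).
have z_cv (w : 'rV[C]_n.+1) : (fun j => hdot (z_ j) w) @ \oo --> (w 0 0)^*.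
  apply/cvg_nsqP => e e0; near=> j.
  rewrite -hdot_e1l -hdotBl (le_lt_trans (hdot_cauchy_schwarz _ _))//.
  apply: (@le_lt_trans _ _ (hsq (z_ j - e1) * (hsq w + 1))).
    by rewrite ler_wpM2l ?hsq_ge0// lerDl.
  rewrite -ltr_pdivlMr; last by rewrite ltr_wpDl// hsq_ge0.
  apply: (@lt_trans _ _ j.+1%:R^-1); first by case: (zP j).
  by near: j; apply: inv0; rewrite divr_gt0// ltr_wpDl// hsq_ge0.
have phi_cv : (fun j => phi (z_ j) 0 0) @ \oo --> (1 : C).
  apply/cvg_nsqP => e e0; near=> j; rewrite nsq_distC.
  by apply: (@lt_trans _ _ j.+1%:R^-1); [case: (zP j)|near: j; exact: inv0].
have q_cv : (fun j => q (z_ j)) @ \oo --> L.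
  apply/cvgrPdist_lt => e e0; near=> j; rewrite distrC.
  by apply: (@lt_trans _ _ j.+1%:R^-1); [case: (zP j)|near: j; exact: inv0].
have K_cv w : cball w -> (fun j => K (z_ j) w) @ \oo --> (h w)^*.
  move=> w1; have nB : \forall j \near \oo, cball (z_ j) by exact: nearW.
  exact: (cvg_sa_kernel phi_SA w1 nB phi_cv (z_cv w)).
(* The j-th kernel puts the point [z_ j] in place of [None], so it is a pullback of [K] and inherits
   positivity. *)
apply: (@psd_kernel_lim _ _ _ \oo _ D
  (fun j u v => K (odflt (z_ j) u) (odflt (z_ j) v))) => [j N x c Dx|].
  by apply: (psd_sa_kernel phi_SA) => i; have := Dx i; case: (x i) => /=.
move=> [z|] [w|] Du Dv; rewrite /boundary_kernel /odflt /oapp.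
- exact: cvg_cst.
- rewrite -[X in _ --> X]conjCK; under eq_fun do rewrite sa_kernelC.
  exact: cvg_conj (K_cv _ Du).
- exact: K_cv Dv.
- under eq_fun do rewrite sa_kernel_self; exact: cvg_real.
Unshelve. all: by end_near. Qed.

End BoundaryKernel.

(** * Directional derivatives *)

Section DirectionalDerivatives.
Local Open Scope ring_scope.
Set Implicit Arguments.
Unset Strict Implicit.
Context {R : realType} {V : normedModType (cplx R)}.
Local Notation C := (cplx R).
Implicit Types (f g : V -> C) (a v : V).

Lemma is_derive_affine f a v (c : C) :
  (forall t : C, f (t *: v + a) - f a = t * c) -> is_derive a v f c.
Proof.
move=> fE; have cv : (fun t : C => t^-1 *: ((f \o shift a) (t *: v) - f a)) @ 0^' --> c.
  apply: cvg_near_cst; near=> t; rewrite /= fE /GRing.scale /= mulrA mulVf ?mul1r//.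
  by near: t; exact: nbhs_dnbhs_neq.
by apply: DeriveDef; [apply/cvg_ex; exists c|exact: cvg_lim cv].
Unshelve. all: by end_near. Qed.

Lemma is_derive_quotient f g a v (df dg : C) :
  is_derive a v f df -> is_derive a v g dg -> g a != 0 ->
  is_derive a v (fun z => f z / g z) ((df * g a - f a * dg) / g a ^+ 2).
Proof.
move=> fa ga ga0.
have gV : is_derive a v (fun z => (g z)^-1) (- (g a) ^- 2 *: dg).
  apply: DeriveDef; first by apply: derivableV => //; case: ga.
  by rewrite deriveV ?derive_val//; case: ga.
have := is_deriveM fa gV; set d := (X in is_derive _ _ _ X -> _) => fg.
suff <- : d = (df * g a - f a * dg) / g a ^+ 2 by [].
by rewrite /d /GRing.scale /=; field.
Qed.

Lemma is_derive_1sub f a v (df : C) : is_derive a v f df ->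
  is_derive a v (fun z => 1 - f z) (- df).
Proof.
move=> fa; have := is_deriveB (is_derive_cst (1 : C) a v) fa.
by rewrite sub0r.
Qed.

Lemma cvg_line a v : (fun t : C => t *: v + a) @ 0^' --> a.
Proof.
rewrite -[X in _ --> X](add0r a).
apply: cvgD; last exact: cvg_cst.
rewrite -(scale0r v); apply: cvgZr_tmp; exact: nbhs_dnbhs.
Qed.

(** Divide the bound on increments by |t|^2 and let t tend to 0. The kernel estimates yield a bound
    at the moving point, and continuity of [M] brings it back to a. *)
Lemma nsq_derive_le f a v (M : V -> R) : derivable f a v -> M @ a --> M a ->
  (\forall t \near (0 : C)^', nsq (f (t *: v + a) - f a) <= nsq t * M (t *: v + a)) ->
  nsq ('D_v f a) <= M a.
Proof.
move=> fa Ma fM.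
have cf : (fun t : C => nsq (t^-1 *: ((f \o shift a) (t *: v) - f a))) @ 0^' --> nsq ('D_v f a).
  exact: cvg_nsq.
have cM : (fun t : C => M (t *: v + a)) @ 0^' --> M a.
  by apply: cvg_comp Ma; exact: cvg_line.
apply: ler_cvg_to cf cM _; near=> t.
have t0 : t != 0 by near: t; exact: nbhs_dnbhs_neq.
rewrite nsqM nsqV ler_pdivrMl ?nsq_gt0//=.
by near: t.
Unshelve. all: by end_near. Qed.

End DirectionalDerivatives.

(** * Estimates at points of the ball *)

Section PointEstimates.
Local Open Scope ring_scope.
Set Implicit Arguments.
Unset Strict Implicit.
Context {R : realType} {n m : nat}.
Local Notation C := (cplx R).
Local Notation Re := (@complex.Re R).
Local Notation e1 := (basis_vec ord0).
Variable phi : 'rV[C]_n.+1 -> 'rV[C]_m.+1.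
Hypothesis phi_SA : schur_agler phi.
Hypothesis phi_C : condition_C phi e1.
Hypothesis phi_e1 : radial_limit phi e1 e1.
Local Notation K := (sa_kernel phi).
Local Notation q := (sa_diag phi).
Local Notation h := (sa_quotient phi).
Local Notation L := (fine (julia_liminf phi e1)).
Local Notation rad r := ((r%:C : C) *: (e1 : 'rV[C]_n.+1)).
Local Notation Kb := (boundary_kernel phi).
Let psd := psd_boundary_kernel phi_SA phi_C phi_e1.
Let herm := boundary_kernelC phi.
Implicit Types a b v w z : 'rV[C]_n.+1.

Lemma julia_liminf_ge0 : 0 <= L.
Proof.
have := @psd 1%N (fun=> None) (fun=> 1) (fun=> I).
by rewrite !big_ord1 -conjcE conjc1 !mul1r /= lecR.
Qed.

Lemma julia_inequality z : cball z -> nsq (h z) <= L * q z.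
Proof.
move=> z1; have := @psd_cauchy_schwarz1 R _ _ Kb (Some z) None psd herm z1 I.
by rewrite /boundary_kernel sa_kernel_self /= mulrC.
Qed.

(* [gap w] is the squared distance between the kernel functions at [e1] and [w]. *)
Definition gap w : R := L - 2 * Re (h w) + q w.

Lemma gapE w : Re (pairing Kb 1 None (-1) (Some w) 1 None (-1) (Some w)) = gap w.
Proof.
rewrite /pairing /boundary_kernel sa_kernel_self rmorphN1 conjC1 /gap.
rewrite !(mulrN1, mulNr, mul1r, mulrN, opprK).
by rewrite !ReD !ReN Re_conj /=; ring.
Qed.

Lemma gap_ge0 w : cball w -> 0 <= gap w.
Proof.
move=> w1; rewrite -gapE.
exact: (@pairing_self_ge0 R _ _ Kb 1 None (-1) (Some w) psd I w1).
Qed.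

(** Nonnegativity of |phi(w) - e_1|^2 says 1 - |phi(w)|^2 <= 2 Re (1 - phi_1(w)). On the radius 1 -
    w_1 = 1 - r is real, so dividing by it gives (1 + r) q <= 2 Re h. *)
Lemma gap_radial r : 0 < r -> r < 1 -> gap (rad r) <= L - r * q (rad r).
Proof.
move=> r0 r1; have B := radial_cball n r0 r1; set w := rad r.
have w0 : 1 - w 0 0 = (1 - r)%:C by rewrite mxE e1_coord mulr1 rmorphB.
have hw0 : 1 - phi w 0 0 = h w * (1 - r)%:C.
  by rewrite /sa_quotient w0 divfK// (inj_eq (@complexI R)) subr_eq0 gt_eqF.
have hw : Re (h w) * (1 - r) = Re (1 - phi w 0 0).
  by rewrite hw0 ReM /= mulr0 subr0.
have := hsq_ge0 (phi w - e1); rewrite hsqB hsq_basis hdot_basisr => p0.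
have := sa_diag_mul phi B; rewrite -/w hsq_radial => qw.
have r2 : q w * (1 + r) <= 2 * Re (h w).
  rewrite -(ler_pM2r (_ : 0 < 1 - r)) ?subr_gt0//.
  rewrite -[leRHS]mulrA hw ReB /=.
  have -> : q w * (1 + r) * (1 - r) = q w * (1 - r ^+ 2) by ring.
  by rewrite qw; lra.
by rewrite /gap; lra.
Qed.

Lemma gap_small (e : R) : 0 < e -> exists r, [/\ 0 < r, r < 1 & gap (rad r) < e].
Proof.
move=> e0; have L0 := julia_liminf_ge0; have d0 : 0 < e / 2 by rewrite divr_gt0.
suff : \forall r \near (1 : R)^'-, [/\ 0 < r, r < 1 & gap (rad r) < e] by move=> /filter_ex.
have M0 : 0 < L + 1 by rewrite ltr_wpDl.
(* The lower limit enters from below: the gap is at most L - r q < L (1 - r) + r e / 2. *)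
have near_q : \forall r \near (1 : R)^'-, L - e / 2 < q (rad r).
  have H := @cvg_radial R n _ (sa_diag_gt phi_SA phi_C d0).
  exact: H.
near=> r; have [r0 r1] : 0 < r /\ r < 1 by near: r; exact: near_left1.
split=> //; rewrite (le_lt_trans (gap_radial r0 r1))//.
have q1 : L - e / 2 < q (rad r).
  by near: r; exact: near_q.
have : L * (1 - r) < e / 2.
  apply: (@le_lt_trans _ _ ((L + 1) * (1 - r))); first by nra.
  rewrite mulrC -ltr_pdivlMr// ltrBlDl -ltrBlDr; near: r; apply: nbhs_left_gt.
  by rewrite ltrBlDl ltrDr; exact: divr_gt0 d0 M0.
by nra.
Unshelve. all: by end_near. Qed.

(** Pair the difference of the kernel functions at e_1 and w with the one at e_1, of squared norm L;
    pairing it with the one at z gives the next estimate. *)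
Lemma nsq_quotient_sub_liminf w : cball w -> nsq (L%:C - h w) <= gap w * L.
Proof.
move=> w1.
have := @psd_cauchy_schwarz R _ _ Kb 1 None (-1) (Some w) 1 None 0 None
  psd herm I w1 I I.
rewrite gapE /pairing !conjC1 !conjC0 !(mul1r, mulr1, mulr0, mul0r, addr0) /=.
by rewrite mulN1r.
Qed.

Lemma nsq_quotient_sub_kernel z w : cball z -> cball w ->
  nsq (h z - K z w) <= q z * gap w.
Proof.
move=> z1 w1.
have := @psd_cauchy_schwarz R _ _ Kb 1 (Some z) 0 (Some z) 1 None (-1) (Some w)
  psd herm z1 z1 I w1.
rewrite gapE /pairing !conjC1 !conjC0 rmorphN1 !(mul1r, mulr1, mulr0, mul0r, addr0) /=.
by rewrite mulN1r sa_kernel_self.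
Qed.

(** The coefficient of |t|^2 in [pseudohyperbolic_line]. Divided by (1 - |a|^2)^2 it is, up to a
    constant, the squared Bergman length of v at a. *)
Definition weight a v : R := hsq v * (1 - hsq a) + nsq (hdot v a).

Lemma weight_ge0 a v : cball a -> 0 <= weight a v.
Proof.
move=> /cball_hsq a1; rewrite addr_ge0 ?nsq_ge0// mulr_ge0 ?hsq_ge0//.
by rewrite subr_ge0 ltW.
Qed.

(* The combination [(1 - <b,a>) k_b - (1 - |a|^2) k_a] of kernel functions is chosen so
   that its norm has no denominator left but the one in [q b]. *)
Lemma two_point_norm a v (t : C) : let b := t *: v + a in cball a -> cball b ->
  let c := 1 - hdot b a in let d := - (1 - hsq a)%:C in
  Re (pairing Kb c (Some b) d (Some a) c (Some b) d (Some a)) =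
  nsq t * weight a v * q b - (1 - hsq a) * hsq (phi b - phi a).
Proof.
move=> b a1 b1 c d.
have nz : c != 0 by apply: ball_hdot_neq0 => //; apply/ltW; exact/cball_hsq.
have cK : c * K b a = 1 - hdot (phi b) (phi a) by rewrite mulrC divfK.
have aK : (1 - hsq a) * q a = 1 - hsq (phi a) by rewrite mulrC sa_diag_mul.
have bK : q b * (1 - hsq b) = 1 - hsq (phi b) by rewrite sa_diag_mul.
have dc : d^* = d by rewrite /d rmorphN /= -conjcE conjc_real.
have P : nsq c = nsq t * weight a v + (1 - hsq a) * (1 - hsq b).
  by have := pseudohyperbolic_line a v t; rewrite -/b -/c -/(weight a v) => <-; ring.
have -> : pairing Kb c (Some b) d (Some a) c (Some b) d (Some a) =
    (nsq c * q b)%:C + d * (c * K b a + (c * K b a)^*) + ((1 - hsq a) * (1 - hsq (phi a)))%:C.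
  have RM (x y : R) : ((x * y)%:C : C) = x%:C * y%:C by rewrite rmorphM.
  rewrite -aK (RM (nsq c)) !(RM (1 - hsq a)) (rmorphM Num.conj c) -mul_conj.
  rewrite /pairing /boundary_kernel !sa_kernel_self (sa_kernelC phi b a) dc.
  by rewrite /d /=; ring.
(* The part (1 - |a|^2) (1 - |b|^2) of |c|^2 cancels the denominator of [q b]; what remains besides
   the weight assembles into |phi b - phi a|^2. *)
have Pq : nsq c * q b = nsq t * weight a v * q b + (1 - hsq a) * (1 - hsq (phi b)).
  by rewrite P mulrDl -bK; ring.
rewrite cK Pq !ReD ReM /= !ReD Re_conj ReB /= hsqB; ring.
Qed.

Lemma image_increment a v (t : C) : let b := t *: v + a in cball a -> cball b ->
  (1 - hsq a) * hsq (phi b - phi a) <= nsq t * weight a v * q b.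
Proof.
move=> b a1 b1; rewrite -subr_ge0 -two_point_norm//.
exact: (@pairing_self_ge0 R _ _ Kb _ (Some b) _ (Some a) psd b1 a1).
Qed.

Lemma quotient_increment a v w (t : C) : let b := t *: v + a in
  cball a -> cball b -> cball w ->
  nsq ((1 - hdot b a) * (h b - K b w) - (1 - hdot a a) * (h a - K a w)) <=
  nsq t * (gap w * weight a v * q b).
Proof.
move=> b a1 b1 w1.
have := @psd_cauchy_schwarz R _ _ Kb (1 - hdot b a) (Some b) (- (1 - hsq a)%:C) (Some a)
  1 None (-1) (Some w) psd herm b1 a1 I w1.
rewrite gapE (two_point_norm a1 b1); set X := pairing _ _ _ _ _ _ _ _ _.
have -> : X = (1 - hdot b a) * (h b - K b w) - (1 - hdot a a) * (h a - K a w).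
  rewrite /X /pairing conjC1 rmorphN1 hdot_self rmorphB rmorph1 /=; ring.
move=> /le_trans; apply.
have := gap_ge0 w1; have := hsq_ge0 (phi b - phi a).
move: a1 => /cball_hsq a1 f0 g0.
have : 0 <= (1 - hsq a) * hsq (phi b - phi a) * gap w.
  by rewrite mulr_ge0// mulr_ge0// subr_ge0 ltW.
lra.
Qed.

End PointEstimates.

(** * Directional derivatives of phi_1 at a point of the ball *)

Section DerivativeEstimates.
Local Open Scope ring_scope.
Set Implicit Arguments.
Unset Strict Implicit.
Context {R : realType} {n m : nat}.
Local Notation C := (cplx R).
Local Notation Re := (@complex.Re R).
Local Notation e1 := (basis_vec ord0).
Variable phi : 'rV[C]_n.+1 -> 'rV[C]_m.+1.
Hypothesis phi_SA : schur_agler phi.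
Hypothesis phi_C : condition_C phi e1.
Hypothesis phi_e1 : radial_limit phi e1 e1.
Local Notation K := (sa_kernel phi).
Local Notation q := (sa_diag phi).
Local Notation h := (sa_quotient phi).
Local Notation phi1 := (fun z => phi z 0 0).
Implicit Types a v w z : 'rV[C]_n.+1.

Lemma cvg_phi a : cball a -> phi @ a --> phi a.
Proof.
by case: phi_SA => _ d _ a1; exact: differentiable_continuous (d a a1).
Qed.

Lemma cvg_sa_diag a : cball a -> q @ a --> q a.
Proof.
move=> a1; have d0 : 1 - hsq a != 0 by move: a1 => /cball_hsq a1; rewrite subr_eq0 gt_eqF.
have cN : (fun z => 1 - hsq (phi z)) @ a --> 1 - hsq (phi a).
  exact: cvgB (cvg_cst _) (cvg_hsq (cvg_phi a1)).
have cD : (fun z => 1 - hsq z) @ a --> 1 - hsq a.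
  have c := @cvg_hsq R _ (nbhs a) (nbhs_filter a) _ id a (@cvg_id _ _).
  exact: cvgB (cvg_cst _) c.
exact: cvgM cN (cvgV d0 cD).
Qed.

Lemma near_line a v : cball a -> \forall t \near (0 : C)^', cball (t *: v + a).
Proof.
move=> /cball_hsq a1.
have c : (fun t : C => t *: v + a) @ (0 : C)^' --> a by exact: cvg_line.
near=> t; apply/cball_hsq; near: t.
exact: cvgr_lt (cvg_hsq c) _ a1.
Unshelve. all: by end_near. Qed.

Lemma derivable_hdot_phi a v (w : 'rV[C]_m.+1) : cball a ->
  derivable (fun z => hdot (phi z) w) a v.
Proof.
move=> a1; apply: diff_derivable.
have -> : (fun z => hdot (phi z) w) = \sum_(i < m.+1) (fun z => phi z 0 i * (w 0 i)^*).
  by apply/funext => z; rewrite fct_sumE hdot.unlock.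
apply: differentiable_sum => i; apply: differentiableM; last exact: differentiable_cst.
apply: (@differentiable_comp _ _ _ _ phi (fun M : 'rV[C]_m.+1 => M 0 i)).
  by case: phi_SA => _ d _; exact: d a a1.
exact: differentiable_coord.
Qed.

(** A Schwarz-Pick estimate: the infinitesimal form of [image_increment], the inner product with w
    being a contraction. *)
Lemma nsq_derive_hdot_phi a v (w : 'rV[C]_m.+1) : cball a -> hsq w <= 1 ->
  (1 - hsq a) * nsq ('D_v (fun z => hdot (phi z) w) a) <= weight a v * q a.
Proof.
move=> a1 w1; have d0 : 0 < 1 - hsq a by move: a1 => /cball_hsq; rewrite subr_gt0.
rewrite mulrC -ler_pdivlMr// -mulrA mulrC.
apply: (nsq_derive_le (M := fun z => q z / (1 - hsq a) * weight a v)).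
- exact: derivable_hdot_phi.
- exact: cvgMr_tmp (cvgMr_tmp (cvg_sa_diag a1)).
near=> t.
have b1 : cball (t *: v + a) by near: t; exact: near_line.
rewrite -hdotBl (le_trans (hdot_cauchy_schwarz _ _))//.
apply: (@le_trans _ _ (hsq (phi (t *: v + a) - phi a))); first by rewrite ler_piMr ?hsq_ge0.
rewrite (_ : nsq t * _ = nsq t * weight a v * q (t *: v + a) / (1 - hsq a)); last by ring.
rewrite ler_pdivlMr// mulrC.
exact: (image_increment phi_SA phi_C phi_e1 a1 b1).
Unshelve. all: by end_near. Qed.

(* [DF] and [DP] are the derivatives at [a] of [h - K(., w)] and [K(., w)], where
   [phi_1 = 1 - (1 - z_1) h]. *)
Lemma derive_phi1_split a v w : cball a -> cball w -> exists DF DP : C,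
  [/\ 'D_v phi1 a - v 0 0 * h a = - (1 - a 0 0) * (DF + DP),
      (1 - hsq a) ^+ 2 * nsq DF <= 4 * (gap phi w * weight a v * q a) &
      (1 - hsq a) * (nsq (1 - hdot a w) ^+ 2 * nsq DP) <=
      2 * (weight a v * q a) * nsq (1 - hdot a w) +
      8 * (1 - hsq a) * nsq (hdot v w)].
Proof.
move=> a1 w1.
have hsq_le1 z : cball z -> hsq z <= 1 by move=> /cball_hsq /ltW.
have phi1E : phi1 = (fun z => hdot (phi z) e1) by apply/funext => z; rewrite hdot_basisr.
set p := 'D_v _ a; set D := 'D_v (fun z => hdot (phi z) (phi w)) a.
have dphi1 : is_derive a v phi1 p.
  by apply: derivableP; rewrite phi1E; exact: derivable_hdot_phi.
have dphi : is_derive a v (fun z => hdot (phi z) (phi w)) D.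
  by apply: derivableP; exact: derivable_hdot_phi.
have dhdot u : is_derive a v (fun z => hdot z u) (hdot v u).
  by apply: is_derive_affine => t; rewrite hdotDl hdotZl addrK.
have dcoord : is_derive a v (fun z => z 0 0) (v 0 0).
  by apply: is_derive_affine => t; rewrite !mxE addrK.
have a_e1 : 1 - a 0 0 != 0.
  by rewrite -hdot_basisr; apply: ball_hdot_neq0; rewrite ?hsq_basis.
have a_w : 1 - hdot a w != 0 by apply: ball_hdot_neq0 => //; exact: hsq_le1.
have dh := is_derive_quotient (is_derive_1sub dphi1) (is_derive_1sub dcoord) a_e1.
have dP := is_derive_quotient (is_derive_1sub dphi) (is_derive_1sub (dhdot w)) a_w.
set Dh := (X in is_derive _ _ _ X) in dh; set DP := (X in is_derive _ _ _ X) in dP.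
have dF : is_derive a v (fun z => h z - K z w) (Dh - DP) := is_deriveB dh dP.
exists (Dh - DP), DP; split.
- by rewrite subrK /Dh /sa_quotient; field.
(* [quotient_increment] controls (1 - <z,a>) (h - K(., w)), not the second factor alone. The product
   rule at a recovers [DF] up to the term <v,a> (h a - K a w), bounded by Cauchy-Schwarz. *)
- have dG := is_deriveM (is_derive_1sub (dhdot a)) dF.
  set G := (X in is_derive _ _ X _) in dG; set DG := (X in is_derive _ _ _ X) in dG.
  have DGle : nsq DG <= gap phi w * weight a v * q a.
    have <- : 'D_v G a = DG by exact: derive_val.
    apply: (nsq_derive_le (M := fun z => gap phi w * weight a v * q z)).
    + by case: dG.
    + exact: cvgMl_tmp (cvg_sa_diag a1).
    near=> t; have b1 : cball (t *: v + a) by near: t; exact: near_line.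
    exact: (quotient_increment phi_SA phi_C phi_e1 a1 b1 w1).
  have -> : (1 - hsq a) ^+ 2 * nsq (Dh - DP) = nsq (DG + hdot v a * (h a - K a w)).
    rewrite -nsq_real -nsqM; congr nsq.
    by rewrite /DG /GRing.scale /= hdot_self rmorphB rmorph1 /sa_quotient /sa_kernel; ring.
  rewrite (le_trans (nsqD_le _ _))// nsqM.
  have F2 := nsq_quotient_sub_kernel phi_SA phi_C phi_e1 a1 w1.
  have g0 := gap_ge0 phi_SA phi_C phi_e1 w1.
  have q0 := sa_diag_ge0 phi_SA a1.
  have : nsq (hdot v a) * nsq (h a - K a w) <= weight a v * (q a * gap phi w).
    apply: ler_pM; rewrite ?nsq_ge0// lerDr mulr_ge0 ?hsq_ge0// subr_ge0.
    exact: hsq_le1.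
  by lra.
- have := nsq_derive_hdot_phi v a1 (ltW (phi_cball phi_SA w1)); rewrite -/D => Dle.
  have -> : nsq (1 - hdot a w) ^+ 2 * nsq DP =
      nsq (- D * (1 - hdot a w) + (1 - hdot (phi a) (phi w)) * hdot v w).
    by rewrite -nsqX2 -nsqM; congr nsq; rewrite /DP; field.
  (* A crude bound suffices: w will stay fixed while a tends to e_1, so 1 - <a,w> stays away from
     0. *)
  have N4 : nsq (1 - hdot (phi a) (phi w)) <= 4.
    rewrite (le_trans (nsqB_le _ _))// nsq1.
    have := hdot_cauchy_schwarz (phi a) (phi w).
    have := phi_cball phi_SA a1; have := phi_cball phi_SA w1.
    by have := hsq_ge0 (phi a); have := hsq_ge0 (phi w); nra.
  have d0 : 0 <= 1 - hsq a by rewrite subr_ge0 hsq_le1.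
  apply: (@le_trans _ _ ((1 - hsq a) *
    (2 * (nsq D * nsq (1 - hdot a w)) + 2 * (4 * nsq (hdot v w))))).
    apply: ler_wpM2l => //; rewrite (le_trans (nsqD_le _ _))// !nsqM nsqN.
    by rewrite lerD2l ler_pM2l// ler_wpM2r ?nsq_ge0.
  have := ler_wpM2r (nsq_ge0 (1 - hdot a w)) Dle.
  by lra.
Unshelve. all: by end_near. Qed.

End DerivativeEstimates.

(** * Limits in Koranyi regions *)

Section KoranyiLimits.
Local Open Scope ring_scope.
Set Implicit Arguments.
Unset Strict Implicit.
Context {R : realType} {n m : nat}.
Local Notation C := (cplx R).
Local Notation Re := (@complex.Re R).
Local Notation e1 := (basis_vec ord0).
Variable phi : 'rV[C]_n.+1 -> 'rV[C]_m.+1.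
Hypothesis phi_SA : schur_agler phi.
Hypothesis phi_C : condition_C phi e1.
Hypothesis phi_e1 : radial_limit phi e1 e1.
Variable alpha : R.
Local Notation K := (sa_kernel phi).
Local Notation q := (sa_diag phi).
Local Notation h := (sa_quotient phi).
Local Notation L := (fine (julia_liminf phi e1)).
Local Notation phi1 := (fun z => phi z 0 0).
Local Notation rad r := ((r%:C : C) *: (e1 : 'rV[C]_n.+1)).
Local Notation region := (koranyi (e1 : 'rV[C]_n.+1) alpha).
Local Notation near_e1 := (within region (nbhs (e1 : 'rV[C]_n.+1))).
Local Notation M := (alpha ^+ 2 * L).
Implicit Types v w z : 'rV[C]_n.+1.

Let FF : Filter near_e1. Proof. exact: within_filter. Qed.

Lemma koranyi_cball z : region z -> cball z.
Proof. by case. Qed.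

Lemma koranyi_nsq z : region z ->
  nsq (1 - z 0 0) <= (alpha / 2) ^+ 2 * (1 - hsq z) ^+ 2.
Proof.
case=> _; rewrite dotmx_hdot hdot_basisr sqnorm_hsq => /lenorm_nsq.
by rewrite exprMn.
Qed.

(** From q (1 - |z|^2) = 1 - |phi|^2 <= 2 |1 - phi_1| = 2 |h| |1 - z_1| and the region's inequality,
    q <= alpha |h|. Julia's inequality then gives q^2 <= alpha^2 L q. *)
Lemma koranyi_diag_le z : region z -> q z <= M.
Proof.
move=> zD; have z1 := koranyi_cball zD; have kz := koranyi_nsq zD.
have d0 : 0 < 1 - hsq z by move: z1 => /cball_hsq; rewrite subr_gt0.
have q0 := sa_diag_ge0 phi_SA z1; have L0 := julia_liminf_ge0 phi_SA phi_C phi_e1.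
have hz : nsq (1 - phi z 0 0) = nsq (h z) * nsq (1 - z 0 0).
  rewrite -nsqM divfK// -hdot_basisr.
  by apply: ball_hdot_neq0; rewrite ?hsq_basis.
have J := julia_inequality phi_SA phi_C phi_e1 z1.
have N2 : (q z * (1 - hsq z)) ^+ 2 <= 4 * nsq (1 - phi z 0 0).
  have := hsq_phi_sub_e1 phi_SA z1; have := sa_diag_mul phi z1.
  have := hsq_ge0 (phi z - e1); rewrite hsqB hsq_basis hdot_basisr => p0 qz _.
  have N1 : q z * (1 - hsq z) <= 2 * Re (1 - phi z 0 0) by rewrite qz ReB /=; lra.
  have N0 : 0 <= q z * (1 - hsq z) by rewrite mulr_ge0// ltW.
  have := sqr_Re_le (1 - phi z 0 0).
  by move: N0 N1; move: (q z * _) (Re _) (nsq _) => x y s; nra.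
have : q z * q z * (1 - hsq z) ^+ 2 <= M * q z * (1 - hsq z) ^+ 2.
  have : nsq (h z) * nsq (1 - z 0 0) <= L * q z * ((alpha / 2) ^+ 2 * (1 - hsq z) ^+ 2).
    by apply: ler_pM; rewrite ?nsq_ge0.
  by move: N2; rewrite hz; lra.
rewrite ler_pM2r ?exprn_gt0// => qq.
have [->|qn] := eqVneq (q z) 0; first by rewrite mulr_ge0 ?sqr_ge0.
by rewrite -(ler_pM2r (_ : 0 < q z))// lt_def qn.
Qed.

Lemma near_koranyi : \forall z \near near_e1, region z.
Proof. exact: withinT. Qed.

Lemma near_koranyi_cball : \forall z \near near_e1, cball z.
Proof. exact: filterS koranyi_cball near_koranyi. Qed.

Lemma cvg_near_e1 : near_e1 --> (e1 : 'rV[C]_n.+1).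
Proof. exact: cvg_within. Qed.

Lemma cvg_coord1 : (fun z => nsq (1 - z 0 0)) @ near_e1 --> (0 : R).
Proof.
have -> : 0 = nsq (1 - (e1 : 'rV[C]_n.+1) 0 0) by rewrite e1_coord subrr nsq0.
have c := @cvg_coord R _ near_e1 FF _ id _ ord0 cvg_near_e1.
apply: (@cvg_nsq R _ near_e1 _ (fun z => 1 - z 0 0)).
exact: cvgB (cvg_cst _) c.
Qed.

(** Here 1 - phi_1 = h (1 - z_1), and |h|^2 <= L q <= L M on the region. *)
Lemma near_phi1 : phi1 @ near_e1 --> (1 : C).
Proof.
apply/cvg_nsqP => e e0; near=> z; rewrite nsq_distC.
have zD : region z by near: z; exact: near_koranyi.
have z1 := koranyi_cball zD.
have L0 := julia_liminf_ge0 phi_SA phi_C phi_e1.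
have -> : 1 - phi z 0 0 = h z * (1 - z 0 0).
  by rewrite divfK// -hdot_basisr; apply: ball_hdot_neq0; rewrite ?hsq_basis.
have J := julia_inequality phi_SA phi_C phi_e1 z1.
have qM := koranyi_diag_le zD.
rewrite nsqM; apply: (@le_lt_trans _ _ ((L * M) * nsq (1 - z 0 0))).
  by apply: ler_wpM2r; rewrite ?nsq_ge0// (le_trans J)// ler_wpM2l.
near: z.
have c : (fun z => L * M * nsq (1 - z 0 0)) @ near_e1 --> L * M * 0.
  exact: cvgMl_tmp cvg_coord1.
by rewrite mulr0 in c; exact: cvgr_lt c _ e0.
Unshelve. all: by end_near. Qed.

Lemma koranyi_quotient : h @ near_e1 --> (L%:C : C).
Proof.
apply/cvg_nsqP => e e0.
have L0 := julia_liminf_ge0 phi_SA phi_C phi_e1.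
(* Splitting h - L into three terms costs factors 2, 4, 4: the first and last give (2 M + 4 L) times
   the gap, the middle one 4 (e / 8). The 1 keeps the divisor positive if L = 0. *)
have c0 : 0 < 2 * M + 4 * L + 1.
  by rewrite ltr_wpDl// addr_ge0// mulr_ge0// mulr_ge0// sqr_ge0.
have e2 : 0 < e / 2 by rewrite divr_gt0.
have [r [r0 r1 gw]] := gap_small phi_SA phi_C phi_e1 (divr_gt0 e2 c0).
have w1 := radial_cball n r0 r1; set w := rad r in gw w1.
have g0 := gap_ge0 phi_SA phi_C phi_e1 w1.
have hL := nsq_quotient_sub_liminf phi_SA phi_C phi_e1 w1.
have cK : (fun z => K z w) @ near_e1 --> (h w)^*.
  apply: (cvg_sa_kernel phi_SA w1 near_koranyi_cball near_phi1).
  by rewrite -hdot_e1l; exact: (@cvg_hdotl R _ near_e1 FF _ id _ w cvg_near_e1).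
have e8 : 0 < e / 8 by rewrite divr_gt0.
near=> z; have zD : region z by near: z; exact: near_koranyi.
have z1 := koranyi_cball zD.
have A := nsq_quotient_sub_kernel phi_SA phi_C phi_e1 z1 w1.
have qM := koranyi_diag_le zD.
have B : nsq (K z w - (h w)^*) < e / 8 by near: z; move/cvg_nsqP: cK; exact.
have D : nsq ((h w)^* - (L%:C : C)) <= gap phi w * L.
  by rewrite -nsq_conj rmorphB /= conjCK -[(L%:C)^*]conjcE conjc_real nsq_distC.
have -> : h z - (L%:C : C) = (h z - K z w) + ((K z w - (h w)^*) + ((h w)^* - L%:C)) by ring.
have E1 := nsqD_le (h z - K z w) ((K z w - (h w)^*) + ((h w)^* - L%:C)).
have E2 := nsqD_le (K z w - (h w)^*) ((h w)^* - L%:C).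
move: gw; rewrite ltr_pdivlMr// => gw.
have A' : nsq (h z - K z w) <= M * gap phi w by rewrite (le_trans A)// ler_wpM2r.
by move: E1 E2 A' B D gw g0; lra.
Unshelve. all: by end_near. Qed.

(* [S] is the square of the factor by which the derivative in the direction [v] is
   divided: [1] along [e1] and [|1 - z_1|] along the other basis vectors. *)
Lemma koranyi_derivative v (S : 'rV[C]_n.+1 -> R) (e : R) :
  (forall z, region z -> weight z v <= 2 * S z) ->
  (forall z, region z -> nsq (v 0 0) <= S z) -> 0 < e ->
  \forall z \near near_e1, nsq ('D_v phi1 z - v 0 0 * h z) <= e * S z.
Proof.
move=> Sw Sv e0; have L0 := julia_liminf_ge0 phi_SA phi_C phi_e1.
have M0 : 0 <= M by rewrite mulr_ge0// sqr_ge0.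
have a2 : 0 <= alpha ^+ 2 by exact: sqr_ge0.
(* The [DF] part will contribute 4 alpha^2 M times the gap, to be kept below e / 2. *)
have c0 : 0 < 4 * alpha ^+ 2 * M + 1 by rewrite ltr_wpDl// mulr_ge0// // mulr_ge0.
have e2 : 0 < e / 2 by rewrite divr_gt0.
have [r [r0 r1 gw]] := gap_small phi_SA phi_C phi_e1 (divr_gt0 e2 c0).
have w1 := radial_cball n r0 r1; set w := rad r in gw w1.
have g0 := gap_ge0 phi_SA phi_C phi_e1 w1.
have vw : nsq (hdot v w) <= nsq (v 0 0).
  rewrite hdotC hdotZl hdot_e1l nsq_conj nsqM nsq_conj nsq_real.
  by rewrite ler_piMl ?nsq_ge0//; nra.
(* Half the value at e_1, hence a lower bound for |1 - <z,w>|^2 near e_1. *)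
pose c := nsq (1 - hdot e1 w) / 2.
have cp : 0 < c.
  rewrite /c; have -> : 1 - hdot e1 w = (1 - hdot w e1)^* by rewrite rmorphB rmorph1 /= -hdotC.
  rewrite nsq_conj divr_gt0// nsq_gt0.
  by apply: ball_hdot_neq0; rewrite ?hsq_basis.
(* The coefficient of 1 - |z|^2 collected from [DP]. With w fixed, this part vanishes as z tends to
   e_1. *)
pose Cw := alpha ^+ 2 / 2 * (4 * M / c + 8 / c ^+ 2).
have Cw0 : 0 <= Cw.
  have c4 : 0 <= 4 * M / c by exact: divr_ge0 (mulr_ge0 _ M0) (ltW cp).
  have c8 : 0 <= 8 / c ^+ 2 by rewrite divr_ge0// sqr_ge0.
  by rewrite mulr_ge0 ?addr_ge0// divr_ge0.
have near_c : \forall z \near near_e1, c < nsq (1 - hdot z w).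
  have cc := @cvg_hdotl R _ near_e1 FF _ id _ w cvg_near_e1.
  apply: cvgr_gt (cvg_nsq (cvgB (cvg_cst (1 : C)) cc)) _ _.
  by move: cp; rewrite /c; lra.
have near_d : \forall z \near near_e1, Cw * (1 - hsq z) < e / 2.
  have cc := @cvg_hsq R _ near_e1 FF _ id _ cvg_near_e1.
  have c' : (fun z => Cw * (1 - hsq z)) @ near_e1 --> Cw * (1 - hsq (e1 : 'rV[C]_n.+1)).
    exact: cvgMl_tmp (cvgB (cvg_cst _) cc).
  rewrite hsq_basis subrr mulr0 in c'.
  exact: cvgr_lt c' _ e2.
near=> z; have zD : region z by near: z; exact: near_koranyi.
have z1 := koranyi_cball zD; have kz := koranyi_nsq zD; have qM := koranyi_diag_le zD.
have Wz := Sw z zD; have Vz := Sv z zD.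
have q0 := sa_diag_ge0 phi_SA z1; have W0 := weight_ge0 v z1.
have S0 : 0 <= S z := le_trans (nsq_ge0 _) Vz.
have y0 : c < nsq (1 - hdot z w) by near: z.
have dz : Cw * (1 - hsq z) < e / 2 by near: z.
have [DF [DP [-> XF XP]]] := derive_phi1_split phi_SA phi_C phi_e1 v z1 w1.
have Wq : weight z v * q z <= 2 * S z * M by apply: ler_pM.
have d0 : 0 < 1 - hsq z by move: z1 => /cball_hsq; rewrite subr_gt0.
have d1 : 1 - hsq z <= 1 by rewrite gerBl hsq_ge0.
set d := 1 - hsq z in XF XP kz dz d0 d1 *; set y := nsq (1 - hdot z w) in XP y0.
have XF' : d ^+ 2 * nsq DF <= 8 * gap phi w * M * S z.
  rewrite (le_trans XF)//.
  have := ler_wpM2l g0 Wq; lra.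
have XP' : d ^+ 2 * nsq DP <= d * S z * (4 * M / c + 8 / c ^+ 2).
  have yp : 0 < y := lt_trans cp y0.
  (* The extra factor d produces d^2 |DP|^2, as required once the region's inequality replaces |1 -
     z_1|^2 by a multiple of d^2. *)
  have : d * (d * (y ^+ 2 * nsq DP)) <= d * (2 * (2 * S z * M) * y + 8 * d * S z).
    rewrite ler_pM2l// (le_trans XP)// lerD//.
      by rewrite ler_wpM2r ?(ltW yp)// ler_pM2l.
    by rewrite ler_wpM2l ?mulr_ge0 ?(ltW d0)// (le_trans vw).
  have -> : d * (d * (y ^+ 2 * nsq DP)) = d ^+ 2 * nsq DP * y ^+ 2 by ring.
  rewrite -ler_pdivlMr ?exprn_gt0// => /le_trans; apply.
  have -> : d * (2 * (2 * S z * M) * y + 8 * d * S z) / y ^+ 2 =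
      d * S z * (4 * M / y + 8 * d / y ^+ 2) by field; rewrite gt_eqF.
  apply: ler_wpM2l; first by rewrite mulr_ge0// ltW.
  have iy : y^-1 <= c^-1 by rewrite lef_pV2 ?posrE// ltW.
  rewrite lerD//; first by rewrite ler_wpM2l// mulr_ge0.
  rewrite -!exprVn; apply: ler_pM; rewrite ?mulr_ge0 ?exprn_ge0 ?invr_ge0 ?(ltW yp) ?(ltW d0)//.
    by lra.
  by rewrite lerXn2r ?nnegrE ?invr_ge0 ?(ltW yp) ?(ltW cp).
rewrite mulNr nsqN nsqM.
have T1 : nsq (1 - z 0 0) * nsq (DF + DP) <=
    (alpha / 2) ^+ 2 * d ^+ 2 * (2 * nsq DF + 2 * nsq DP).
  by apply: ler_pM; rewrite ?nsq_ge0// nsqD_le.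
rewrite (le_trans T1)//.
have -> : (alpha / 2) ^+ 2 * d ^+ 2 * (2 * nsq DF + 2 * nsq DP) =
    alpha ^+ 2 / 2 * (d ^+ 2 * nsq DF + d ^+ 2 * nsq DP) by field.
have a2' : 0 <= alpha ^+ 2 / 2 by rewrite divr_ge0.
rewrite (le_trans (ler_wpM2l a2' (lerD XF' XP')))//.
have -> : alpha ^+ 2 / 2 * (8 * gap phi w * M * S z + d * S z * (4 * M / c + 8 / c ^+ 2)) =
    (4 * alpha ^+ 2 * M * gap phi w + Cw * d) * S z by rewrite /Cw; field; rewrite gt_eqF.
apply: ler_wpM2r => //.
by move: gw; rewrite ltr_pdivlMr//; move: dz g0; lra.
Unshelve. all: by end_near. Qed.

End KoranyiLimits.

(** * The three K-limits at e_1 *)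

Lemma nsq_principal_sqrt (R : realType) (x : cplx R) :
  nsq (principal_sqrt x) ^+ 2 = nsq x.
Proof. by rewrite -nsqX2 /principal_sqrt sqr_sqrtc. Qed.

Theorem theorem0p9 (R : realType) (n m : nat)
    (phi : 'rV[cplx R]_n.+1 -> 'rV[cplx R]_m.+1) (k : 'I_n.+1)
    (phi_SA : schur_agler phi)
    (phi_C : condition_C phi (basis_vec ord0))
    (phi_e1 : radial_limit phi (basis_vec ord0) (basis_vec ord0))
    (k_ge2 : (0 < k)%N) :
  let phi1 z := phi z 0 ord0 in
  let L : cplx R := (fine (julia_liminf phi (basis_vec ord0)))%:C in
  [/\ K_limit (fun z => (1 - phi1 z) / (1 - z 0 ord0)) (basis_vec ord0) L,
      K_limit (partial_C ord0 phi1) (basis_vec ord0) L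
    & K_limit (fun z => partial_C k phi1 z / principal_sqrt (1 - z 0 ord0))
        (basis_vec ord0) 0].
Proof.
move=> phi1 L.
pose E1 : 'rV[cplx R]_n.+1 := basis_vec ord0.
have weightE (j : 'I_n.+1) (z : 'rV[cplx R]_n.+1) :
    weight z (basis_vec j) = 1 - hsq z + nsq (z 0 j).
  by rewrite /weight hsq_basis mul1r hdotC hdot_basisr nsq_conj.
split=> alpha _;
  have FF : Filter (within (koranyi E1 alpha) (nbhs E1)) by exact: within_filter.
- exact: koranyi_quotient.
- have cq := koranyi_quotient phi_SA phi_C phi_e1 alpha.
  apply/cvg_nsqP => e e0; have e4 : 0 < e / 4 by rewrite divr_gt0.
  (* Along e_1 the derivative estimate with S = 1 shows that D_1 phi_1 - h tends to 0, so (ii)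
     follows from (i). *)
  have Sw (z : 'rV[cplx R]_n.+1) : koranyi E1 alpha z -> weight z (basis_vec ord0) <= 2 * 1.
    by move=> _; rewrite weightE; have := nsq_coord_le z ord0; lra.
  have Sv (z : 'rV[cplx R]_n.+1) : koranyi E1 alpha z ->
      nsq ((basis_vec ord0 : 'rV[cplx R]_n.+1) 0 0) <= 1 by rewrite e1_coord nsq1.
  near=> z.
  have A : nsq ('D_(basis_vec ord0) phi1 z - (basis_vec ord0 : 'rV[cplx R]_n.+1) 0 0 *
      sa_quotient phi z) <= e / 4 * 1.
    by near: z; exact: (koranyi_derivative (S := fun=> 1) phi_SA phi_C phi_e1 Sw Sv e4).
  have B : nsq (sa_quotient phi z - L) < e / 4 by near: z; move/cvg_nsqP: cq; exact.
  rewrite e1_coord mul1r in A.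
  have -> : partial_C ord0 phi1 z - L =
    ('D_(basis_vec ord0) phi1 z - sa_quotient phi z) + (sa_quotient phi z - L).
    by rewrite addrA subrK.
  by rewrite (le_lt_trans (nsqD_le _ _))//; lra.
- apply/cvg_nsqP => e e0; have e2 : 0 < e / 2 by rewrite divr_gt0.
  (* The first coordinate of e_k is 0, so the term v_1 h of the derivative estimate disappears. *)
  have k0 : (basis_vec k : 'rV[cplx R]_n.+1) 0 0 = 0.
    by rewrite mxE eqxx -val_eqE /= eq_sym (gtn_eqF k_ge2).
  (* S is |1 - z_1|. It dominates the weight of e_k because 1 - |z|^2 + |z_k|^2 <= 1 - |z_1|^2 <= 2
     Re (1 - z_1). *)
  pose S (z : 'rV[cplx R]_n.+1) : R := nsq (principal_sqrt (1 - z 0 0)).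
  have Sw (z : 'rV[cplx R]_n.+1) : koranyi E1 alpha z -> weight z (basis_vec k) <= 2 * S z.
    move=> _; rewrite weightE.
    have kz : nsq (z 0 0) + nsq (z 0 k) <= hsq z.
      by apply: nsq_coord2_le; rewrite -val_eqE /= eq_sym (gtn_eqF k_ge2).
    have ReS : complex.Re (1 - z 0 0) <= S z.
      have := sqr_Re_le (1 - z 0 0); rewrite -nsq_principal_sqrt -/(S z).
      have : 0 <= S z := nsq_ge0 _.
      by move: (S z) (complex.Re _) => s x s0 xs; rewrite leNgt; apply/negP => sx; nra.
    have := nsq_ge0 (1 - z 0 0); move: ReS kz; rewrite /nsq ReB ImB /=.
    by lra.
  have Sv (z : 'rV[cplx R]_n.+1) : koranyi E1 alpha z ->
      nsq ((basis_vec k : 'rV[cplx R]_n.+1) 0 0) <= S z by rewrite k0 nsq0 nsq_ge0.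
  near=> z; rewrite subr0 nsqM nsqV.
  have z1 : cball z by near: z; exact: near_koranyi_cball.
  have A : nsq ('D_(basis_vec k) phi1 z - (basis_vec k : 'rV[cplx R]_n.+1) 0 0 *
      sa_quotient phi z) <= e / 2 * S z.
    by near: z; exact: (koranyi_derivative phi_SA phi_C phi_e1 Sw Sv e2).
  rewrite k0 mul0r subr0 in A.
  have Sz : 0 < S z.
    rewrite /S nsq_gt0 sqrtc_eq0 -hdot_basisr.
    by apply: ball_hdot_neq0; rewrite ?hsq_basis.
  rewrite -/(S z) ltr_pdivrMr// (le_lt_trans A)// ltr_pM2r//.
  by lra.
Unshelve. all: by end_near. Qed.
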